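(* Suppose that the families $\{(X^n_{T_n+\varepsilon t})_{t\in[0,1]}\}_\varepsilon$ and $\{(Y^n_{T_n+\varepsilon t})_{t\in[0,1]}\}_\varepsilon$ satisfy the large deviation principles (LD1) and (LD2) described in the context. Let $L,U$ be continuous real functions (lower and upper barriers) with $L_t\le U_t$ for all $t$, and let $I_Y^U$, $I_Y^L$, $I_Y^{L,U}$ be the quantities defined in the context. Then $$I_Y^U=\inf_{t\in[0,1]}\frac{\big((U_{T_n}-x_n)(1-\bar\beta_t)+\bar\beta_t(U_{T_n}-y)\big)^2}{2\,\bar k_Y(t,t)}\quad\text{if }x_n,y<U_{T_n},$$ $$I_Y^L=\inf_{t\in[0,1]}\frac{\big((x_n-L_{T_n})(1-\bar\beta_t)+\bar\beta_t(y-L_{T_n})\big)^2}{2\,\bar k_Y(t,t)}\quad\text{if }x_n,y>L_{T_n},$$ $$I_Y^{L,U}=\min\big(I_Y^L,I_Y^U\big)\quad\text{if }x_n,y\in(L_{T_n},U_{T_n}).$$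
   Context: Let $X=(X_t)_{t\ge0}$ be a continuous centered Gaussian process with continuous covariance function $k(t,s)=\mathrm{Cov}(X_t,X_s)$. Fix $n\ge1$, times $0<T_1<\dots<T_n$ and reals $x_1,\dots,x_n$, $y$. Set $X^0=X$, $k_0=k$ and, for $j=1,\dots,n$, $\alpha_j(t)=k_{j-1}(t,T_j)/k_{j-1}(T_j,T_j)$, $X^j_t=X^{j-1}_t-\alpha_j(t)(X^{j-1}_{T_j}-x_j)$, $k_j(t,s)=k_{j-1}(t,s)-\alpha_j(t)k_{j-1}(s,T_j)$ (with $k_{j-1}(T_j,T_j)>0$). Then $X^n$ has the law of $X$ conditioned on $X_{T_i}=x_i$, $i\le n$, and has covariance $k_n$. The bridge $Y^n$ (depending on $\varepsilon$) is $X^n$ conditioned to be at $y$ at time $T_n+\varepsilon$; in law $Y^n_{T_n+\varepsilon t}=X^n_{T_n+\varepsilon t}-\frac{k_n(T_n+\varepsilon t,T_n+\varepsilon)}{k_n(T_n+\varepsilon,T_n+\varepsilon)}(X^n_{T_n+\varepsilon}-y)$. Standing hypothesis: (LD1) $\{(X^n_{T_n+\varepsilon t})_{t\in[0,1]}\}_\varepsilon$ satisfies a large deviation principle on $C([0,1])$ with inverse speed $\gamma_\varepsilon^2$ and rate function $J_n(h)=\frac12\|h-x_n\|^2_{\bar{\mathscr H}_n}$ if $h_0=x_n$ and $h-x_n\in\bar{\mathscr H}_n$, $J_n(h)=+\infty$ otherwise, where $\bar{\mathscr H}_n$ is the reproducing kernel Hilbert space of a suitable covariance function $\bar k_n$ on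 $[0,1]^2$ with $\bar k_n(1,1)>0$. (LD2) $\{(Y^n_{T_n+\varepsilon t})_{t\in[0,1]}\}_\varepsilon$ satisfies a large deviation principle on $C([0,1])$ with inverse speed $\eta_\varepsilon^2$ and rate function $J_Y(h)=\frac12\|h-\bar m\|^2_{\bar{\mathscr H}_Y}$ if $h_0=x_n$, $h_1=y$ and $h-\bar m\in\bar{\mathscr H}_Y$, $J_Y(h)=+\infty$ otherwise, where $\bar{\mathscr H}_Y$ is the reproducing kernel Hilbert space of a suitable covariance function $\bar k_Y$ on $[0,1]^2$, $\bar m_t=x_n+\bar\beta_t(y-x_n)$ and $\bar\beta_t=\bar k_n(t,1)/\bar k_n(1,1)$. Barrier quantities. Let $\tau^U_\varepsilon=\inf\{t>0:Y^n_{T_n+\varepsilon t}\ge U_{T_n+\varepsilon t}\}$, $\tau^L_\varepsilon=\inf\{t>0:Y^n_{T_n+\varepsilon t}\le L_{T_n+\varepsilon t}\}$, $\tau^{L,U}_\varepsilon=\tau^L_\varepsilon\wedge\tau^U_\varepsilon$. Let $\Gamma_U=\{\gamma\in C([0,1]):\sup_{t\in[0,1]}\gamma_t\ge0\}$, $\Gamma_L=\{\gamma\in C([0,1]):\inf_{t\in[0,1]}\gamma_t\le0\}$, and $$I_Y^U=\inf_{\gamma\in\Gamma_U}J_Y(\gamma+U_{T_n}),\qquad I_Y^L=\inf_{\gamma\in\Gamma_L}J_Y(\gamma+L_{T_n}),$$ so that $\lim_{\varepsilon\to0}\eta_\varepsilon^2\log\mathbb P(\tau^U_\varepsilon\le1)=-I_Y^U$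 and $\lim_{\varepsilon\to0}\eta_\varepsilon^2\log\mathbb P(\tau^L_\varepsilon\le1)=-I_Y^L$; and $I_Y^{L,U}$ is defined by $\lim_{\varepsilon\to0}\eta_\varepsilon^2\log\mathbb P(\tau^{L,U}_\varepsilon\le1)=-I_Y^{L,U}$. Convention for the quotients when $\bar k_Y(t,t)=0$ (e.g. $t=0,1$): $c/0=+\infty$ for $c>0$ and $0/0=0$. $C([0,1])$ carries the sup-norm. A family $\{V^\varepsilon\}_\varepsilon$ of $C([0,1])$-valued random variables satisfies a large deviation principle with inverse speed $\gamma_\varepsilon^2$ and (good) rate function $I$ if $\gamma_\varepsilon\to0$, $\{I\le a\}$ is compact for every real $a$, $\liminf_{\varepsilon\to0}\gamma_\varepsilon^2\log\mathbb P(V^\varepsilon\in G)\ge-\inf_GI$ for every open $G$, and $\limsup_{\varepsilon\to0}\gamma_\varepsilon^2\log\mathbb P(V^\varepsilon\in F)\le-\inf_FI$ for every closed $F$. The reproducing kernel Hilbert space of a continuous, symmetric, positive (semi)definite kernel $q$ on $[0,1]^2$ is the completion, inside $C([0,1])$, of the paths $h_t=\int_0^1q(t,s)\lambda(ds)$, $\lambda$ a signed Borel measure on $[0,1]$, with $\|h\|^2=\int_0^1\int_0^1q(t,s)\lambda(dt)\lambda(ds)$. *)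

(* Defs.v *)
From HB Require Import structures.
From mathcomp Require Import all_boot all_order all_algebra.
From mathcomp Require Import all_classical all_reals all_analysis.

Set Implicit Arguments.
Unset Strict Implicit.
Unset Printing Implicit Defensive.

Import Order.TTheory GRing.Theory Num.Theory.
Import numFieldNormedType.Exports.

Local Open Scope classical_set_scope.
Local Open Scope ring_scope.

(** ** The space C([0,1]) *)

(* Paths are functions on R of which only the values on [0,1] matter: the
   topology is that of uniform convergence on [0,1], and its open (closed,
   compact) sets do not distinguish functions that agree there.  The open and
   closed subsets of C([0,1]) are the traces on [C01] of those of [path01], and a
   subset of [C01] is compact in C([0,1]) iff it is compact in [path01]. *)
Notation path01 R := {uniform` (`[0%R : R, 1%R : R]%classic : set R) -> R}.

Definition C01 (R : realType) : set (path01 R) :=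
  [set h : path01 R | {within `[0, 1], continuous (h : R -> R)}].

(** ** Reproducing kernel Hilbert spaces *)

Definition covariance_function01 (R : realType) (q : R -> R -> R) : Prop :=
  [/\ {within `[0, 1] `*` `[0, 1], continuous (fun p : R * R => q p.1 p.2)},
      forall t s, t \in `[0, 1] -> s \in `[0, 1] -> q t s = q s t
    & forall (m : nat) (t a : 'I_m -> R), (forall i, t i \in `[0, 1]) ->
        0 <= \sum_(i < m) \sum_(j < m) a i * a j * q (t i) (t j)].

(* A signed Borel measure on [0,1] is given by two finite measures, of which it
   is the difference (Jordan decomposition); the two need not be mutually
   singular, and only their restrictions to [0,1] are used. *)
Definition signed_measure (R : realType) : Type :=
  ({finite_measure set (measurableTypeR R) -> \bar R} *
   {finite_measure set (measurableTypeR R) -> \bar R})%type.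

Definition signed_integral (R : realType) (l : signed_measure R) (f : R -> R) :
    R :=
  (\int[l.1]_(s in `[0, 1]) f s - \int[l.2]_(s in `[0, 1]) f s)%R.

Definition measure_path (R : realType) (q : R -> R -> R)
    (l : signed_measure R) : path01 R :=
  fun t : R => signed_integral l (q t).

Definition measure_dot (R : realType) (q : R -> R -> R)
    (l l' : signed_measure R) : R :=
  signed_integral l (measure_path q l').

(* The paths of the measures [l i] are Cauchy for the norm of the kernel [q]
   (the left-hand side below is the squared norm of the path of [l i - l j])
   and converge to [h] in C([0,1]). *)
Definition rkhs_approx (R : realType) (q : R -> R -> R)
    (l : nat -> signed_measure R) (h : path01 R) : Prop :=
  (forall e : R, 0 < e -> exists N : nat, forall i j : nat,
     (N <= i)%N -> (N <= j)%N ->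
     measure_dot q (l i) (l i) - measure_dot q (l i) (l j)
       - measure_dot q (l j) (l i) + measure_dot q (l j) (l j) < e) /\
  (fun i : nat => measure_path q (l i)) @ \oo --> h.

Definition rkhs (R : realType) (q : R -> R -> R) : set (path01 R) :=
  [set h : path01 R | C01 h /\ exists l, rkhs_approx q l h].

(* The squared norm of an element of [rkhs q]: the common limit of the squared
   norms along all approximating sequences. *)
Definition rkhs_sqnorm (R : realType) (q : R -> R -> R) (h : path01 R) : R :=
  xget 0 [set v : R | exists2 l, rkhs_approx q l h &
    measure_dot q (l i) (l i) @[i --> \oo] --> v].

(** ** Large deviations *)

Definition log_probability (d : measure_display) (Omega : measurableType d)
    (R : realType) (P : probability Omega R) (g : R -> R)
    (A : R -> set Omega) (e : R) : \bar R :=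
  ((g e ^+ 2)%:E * lne (P (A e)))%E.

Definition LDP (d : measure_display) (Omega : measurableType d)
    (R : realType) (P : probability Omega R) (V : R -> Omega -> path01 R)
    (g : R -> R) (I : path01 R -> \bar R) : Prop :=
  [/\ (\forall e \near 0^'+, 0 < g e) /\ g e @[e --> 0^'+] --> (0 : R),
      forall a : R, compact [set h : path01 R | C01 h /\ (I h <= a%:E)%E],
      forall G : set (path01 R), open G ->
        (- ereal_inf [set I h | h in G `&` @C01 R] <=
         limf_einf (log_probability P g (fun e => [set w | G (V e w)])) 0^'+)%E
    & forall F : set (path01 R), closed F ->
        (limf_esup (log_probability P g (fun e => [set w | F (V e w)])) 0^'+ <=
         - ereal_inf [set I h | h in F `&` @C01 R])%E].

(** ** Gaussian processes and their conditioning *)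

(* [normal_prob 0 0] is not the law of a constant, hence the case distinction. *)
Definition centered_normal (R : realType) (s : R) :
    set (measurableTypeR R) -> \bar R :=
  if s == 0 then @dirac _ (measurableTypeR R) (0 : R) R
  else normal_prob (0 : R) s.

Definition centered_gaussian_process (d : measure_display)
    (Omega : measurableType d) (R : realType) (P : probability Omega R)
    (X : R -> {RV P >-> R}) : Prop :=
  forall (m : nat) (t a : 'I_m -> R), (forall i, 0 <= t i) ->
    exists s : R, forall A : set (measurableTypeR R), measurable A ->
      P [set w | A (\sum_(i < m) a i * X (t i) w)] = centered_normal s A.

Definition regression (R : realType) (q : R -> R -> R) (s t : R) : R :=
  q t s / q s s.

(* [conditional_covariance k T j] is k_j and [conditional_process X k T x j] is
   X^j; the conditioning times and values are T 1, ..., T n and x 1, ..., x n,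
   and the values of T and x at 0 are not used. *)
Fixpoint conditional_covariance (R : realType) (k : R -> R -> R)
    (T : nat -> R) (j : nat) : R -> R -> R :=
  if j is i.+1 then
    let q := conditional_covariance k T i in
    fun t s => q t s - regression q (T i.+1) t * q s (T i.+1)
  else k.

Fixpoint conditional_process (R : realType) (Omega : Type)
    (X : R -> Omega -> R) (k : R -> R -> R) (T x : nat -> R) (j : nat) :
    R -> Omega -> R :=
  if j is i.+1 then
    let Z := conditional_process X k T x i in
    let q := conditional_covariance k T i in
    fun t w => Z t w - regression q (T i.+1) t * (Z (T i.+1) w - x i.+1)
  else X.

(* The process [Z] with covariance [q] conditioned to be at [y] at time [s]. *)
Definition bridge (R : realType) (Omega : Type) (Z : R -> Omega -> R)
    (q : R -> R -> R) (s y : R) : R -> Omega -> R :=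
  fun t w => Z t w - regression q s t * (Z s w - y).

Definition rescaled_path (R : realType) (Omega : Type) (Z : R -> Omega -> R)
    (T0 e : R) (w : Omega) : path01 R :=
  fun t : R => Z (T0 + e * t) w.

(** ** Rate functions *)

Definition rate_start (R : realType) (q : R -> R -> R) (x0 : R) (h : path01 R) :
    \bar R :=
  let g : path01 R := fun t : R => h t - x0 in
  if `[< h 0 = x0 /\ rkhs q g >] then (2^-1 * rkhs_sqnorm q g)%:E else +oo%E.

Definition bridge_mean (R : realType) (q : R -> R -> R) (x0 y t : R) : R :=
  x0 + regression q 1 t * (y - x0).

Definition rate_bridge (R : realType) (q : R -> R -> R) (m : R -> R)
    (x0 y : R) (h : path01 R) : \bar R :=
  let g : path01 R := fun t : R => h t - m t in
  if `[< [/\ h 0 = x0, h 1 = y & rkhs q g] >]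
  then (2^-1 * rkhs_sqnorm q g)%:E else +oo%E.

(** ** Barriers *)

Definition hit_upper (R : realType) (Omega : Type) (Z : R -> Omega -> R)
    (U : R -> R) (T0 e : R) (w : Omega) : \bar R :=
  ereal_inf [set t%:E |
    t in [set t : R | 0 < t /\ U (T0 + e * t) <= Z (T0 + e * t) w]].

Definition hit_lower (R : realType) (Omega : Type) (Z : R -> Omega -> R)
    (L : R -> R) (T0 e : R) (w : Omega) : \bar R :=
  ereal_inf [set t%:E |
    t in [set t : R | 0 < t /\ Z (T0 + e * t) w <= L (T0 + e * t)]].

Definition Gamma_upper (R : realType) : set (path01 R) :=
  [set h : path01 R | C01 h /\ 0 <= sup [set h t | t in `[0, 1]]].

Definition Gamma_lower (R : realType) : set (path01 R) :=
  [set h : path01 R | C01 h /\ inf [set h t | t in `[0, 1]] <= 0].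

Definition crossing_cost (R : realType) (J : path01 R -> \bar R)
    (Gamma : set (path01 R)) (b : R) : \bar R :=
  ereal_inf [set J (fun t : R => h t + b) | h in Gamma].

(* c / d for c, d >= 0, with c / 0 = +oo for c > 0 and 0 / 0 = 0. *)
Definition quotient0 (R : realType) (c d : R) : \bar R :=
  if d == 0 then (if c == 0 then 0%E else +oo%E) else (c / d)%:E.

(* Main.v *)
(** With m the mean of the limit bridge, the numerators are the squared distances
    (b - m_t)^2 to the barrier level b.  A path h = m + g with g in the RKHS of
    kbar_Y that reaches b at time t costs at least (b - m_t)^2 / (2 kbar_Y(t,t)),
    because the reproducing property gives g_t^2 <= kbar_Y(t,t) ||g||^2, and the
    multiple (b - m_t) kbar_Y(., t) / kbar_Y(t,t) of the kernel section attains
    this bound.  If m itself reaches b, both infima vanish.  The kernel norm is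
    controlled by replacing measures with weights on a grid, which transfers the
    finite-point positivity of the kernel to signed measures.

    The exit event of the two-barrier problem is the union of the two crossing
    events, and max(P(A), P(B)) <= P(A u B) <= 2 max(P(A), P(B)), where the
    factor 2 disappears since eta^2 log 2 -> 0. *)

Require Import Defs.
From mathcomp Require Import all_boot all_order all_algebra.
From mathcomp Require Import all_classical all_reals all_analysis.
From mathcomp Require Import measurable_realfun.
From mathcomp Require Import lra ring.
Set Implicit Arguments.
Unset Strict Implicit.
Unset Printing Implicit Defensive.
Import Order.TTheory GRing.Theory Num.Theory.
Import numFieldNormedType.Exports.
Local Open Scope classical_set_scope.
Local Open Scope ring_scope.

(** * Uniform continuity and paths *)

(** The near-covering form of compactness, applied to the filter of small radii [d], merges the
    local moduli of continuity into one radius. *)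
Lemma compact_uniform_continuity (R : realType) (V : pseudoMetricType R)
    (K : set V) (f : V -> R) :
  compact K -> {within K, continuous f} ->
  forall e : R, 0 < e -> exists2 d : R, 0 < d &
    forall x y, K x -> K y -> ball x d y -> `|f x - f y| < e.
Proof.
move=> /compact_near_coveringP/near_covering_withinP cK.
move=> /subspace_continuousP cf e e0.
have [|d /= d0 H] := cK R (0 : R)^'+
    (fun d x => forall y, K y -> ball x d y -> `|f x - f y| < e) _.
  move=> x Kx.
  have e20 : 0 < e / 2 by rewrite divr_gt0.
  have /cvgrPdist_lt/(_ _ e20) := cf x Kx; rewrite near_withinE.
  move=> /nbhs_ballP[d /= d0 Hd].
  have d20 : 0 < d / 2 by rewrite divr_gt0.
  (* With half the radius, both [x'] and any [y] within [d / 2] of [x'] stay in [ball x d]. *)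
  exists (ball x (d / 2), [set z | z < d / 2]).
    split => /=; first exact: nbhsx_ballx.
    exact: nbhs_right_lt.
  move=> [x' z] /= [xx' zd] Kx' y Ky x'y.
  have xy : ball x d y.
    rewrite (splitr d); apply: ball_triangle xx' _.
    by apply: le_ball x'y; exact: ltW.
  have xx'' : ball x d x'.
    by apply: le_ball xx'; rewrite ler_pdivrMr ?ltr0n// ler_peMr ?ler1n// ltW.
  have h1 : `|f x - f x'| < e / 2 := Hd _ xx'' Kx'.
  have h2 : `|f x - f y| < e / 2 := Hd _ xy Ky.
  move: h1 h2.
  by rewrite !ltr_norml => /andP[? ?] /andP[? ?]; apply/andP; split; lra.
exists (d / 2); first by rewrite divr_gt0.
move=> x y Kx Ky xy; apply: (H (d / 2)) => //=.
  by rewrite sub0r normrN gtr0_norm ?divr_gt0//; move: d0 => /=; lra.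
by rewrite divr_gt0.
Qed.

Lemma within_continuousP (R : realType) (K : set R) (f : R -> R) :
  {within K, continuous f} <->
  forall x, K x -> forall e : R, 0 < e -> exists2 d : R, 0 < d &
    forall y, K y -> `|x - y| < d -> `|f x - f y| < e.
Proof.
split=> [/subspace_continuousP cf x Kx e e0|H].
  have /cvgrPdist_lt/(_ _ e0) := cf x Kx; rewrite near_withinE.
  move=> /nbhs_ballP[d /= d0 Hd]; exists d => // y Ky xy.
  exact: Hd.
apply/subspace_continuousP => x Kx; apply/cvgrPdist_lt => e e0.
have [d d0 Hd] := H x Kx e e0.
rewrite near_withinE; apply/nbhs_ballP; exists d => //= y xy Ky.
exact: Hd.
Qed.

Lemma path01_cvg_uniform (R : realType) (f : nat -> path01 R) (g : path01 R) :
  f @ \oo --> g -> forall e : R, 0 < e ->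
  \forall i \near \oo, forall t, t \in `[0, 1] -> `|g t - f i t| < e.
Proof.
move=> fg e e0.
suff : nbhs g [set h : path01 R | forall t, t \in `[0, 1] -> `|g t - h t| < e].
  by move/fg.
apply/uniform_nbhs; exists [set p : R * R | ball p.1 e p.2]; split.
  by rewrite -entourage_ballE; exists e.
by move=> h /= H t t01; exact: (H t).
Qed.

(** * Integration against signed measures *)

Section SignedIntegral.
Context (R : realType).
Implicit Types (l : signed_measure R) (f g : R -> R).

(** A linear class that contains the continuous functions and the indicators of cells, and on which
    every finite measure can be integrated. *)
Definition bounded_measurable01 f : Prop :=
  measurable_fun (`[0%R, 1%R] : set (measurableTypeR R)) f /\
  exists M : R, forall t, t \in `[0, 1] -> `|f t| <= M.

Lemma bounded_measurable01_cst (c : R) : bounded_measurable01 (fun=> c).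
Proof. by split; [exact: measurable_cst | exists `|c|]. Qed.

Lemma bounded_measurable01D f g : bounded_measurable01 f ->
  bounded_measurable01 g -> bounded_measurable01 (fun t => f t + g t).
Proof.
move=> [mf [M fM]] [mg [N gN]]; split; first exact: measurable_funD.
exists (M + N) => t t01; apply: le_trans (ler_normD _ _) _.
by apply: lerD; [exact: fM | exact: gN].
Qed.

Lemma bounded_measurable01Z (c : R) f : bounded_measurable01 f ->
  bounded_measurable01 (fun t => c * f t).
Proof.
move=> [mf [M fM]]; split; first exact: measurable_funM.
by exists (`|c| * M) => t t01; rewrite normrM ler_wpM2l// fM.
Qed.

Lemma bounded_measurable01_indic (A : set R) :
  measurable (A : set (measurableTypeR R)) -> bounded_measurable01 \1_A.
Proof.
move=> mA; split; first exact: measurable_indic.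
exists 1 => t _; rewrite indicE; case: (t \in A); rewrite ?normr1 ?normr0//.
Qed.

Lemma bounded_measurable01_continuous f :
  {within `[0, 1], continuous f} -> bounded_measurable01 f.
Proof.
move=> cf; split.
  by apply: subspace_continuous_measurable_fun => //; exact: measurable_itv.
have [M [_ HM]] : bounded_set (f @` `[0, 1]).
  apply: compact_bounded; apply: continuous_compact => //.
  exact: segment_compact.
exists (M + 1) => t t01; apply: HM; first by rewrite ltrDl.
by exists t.
Qed.

Lemma integrable01 (mu : {finite_measure set (measurableTypeR R) -> \bar R}) f :
  bounded_measurable01 f -> mu.-integrable `[0, 1] (EFin \o f).
Proof.
move=> [mf [M fM]]; apply: measurable_bounded_integrable => //.
  by rewrite -ge0_fin_numE// fin_num_measure//; exact: measurable_itv.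
exists M; split; first exact: num_real.
by move=> N /ltW MN t t01; apply: le_trans (fM _ t01) MN.
Qed.

Lemma signed_integralD l f g : bounded_measurable01 f ->
  bounded_measurable01 g ->
  signed_integral l (fun t => f t + g t) =
  signed_integral l f + signed_integral l g.
Proof.
move=> bf bg; rewrite /signed_integral.
rewrite !RintegralD; first ring;
  by [exact: integrable01 | exact: measurable_itv].
Qed.

Lemma signed_integralZ l c f : bounded_measurable01 f ->
  signed_integral l (fun t => c * f t) = c * signed_integral l f.
Proof.
move=> bf; rewrite /signed_integral !RintegralZl; first ring;
  by [exact: integrable01 | exact: measurable_itv].
Qed.

(** Since the two parts of [l] may overlap, this is only an upper bound for the total variation on
    [0,1]. *)
Definition mass01 l : R :=
  fine (l.1 `[0, 1]%classic) + fine (l.2 `[0, 1]%classic).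

Lemma mass01_ge0 l : 0 <= mass01 l.
Proof. by rewrite addr_ge0// fine_ge0. Qed.

Lemma signed_integral_le l f (M : R) : bounded_measurable01 f ->
  (forall t, t \in `[0, 1] -> `|f t| <= M) ->
  `|signed_integral l f| <= M * mass01 l.
Proof.
move=> bf fM; rewrite mulrDr; apply: le_trans (ler_normB _ _) _.
have H (mu : {finite_measure set (measurableTypeR R) -> \bar R}) :
    `|\int[mu]_(x in `[0, 1]) f x| <= M * fine (mu `[0, 1]%classic).
  have m01 : measurable (`[0%R, 1%R] : set (measurableTypeR R)).
    exact: measurable_itv.
  apply: le_trans (le_normr_Rintegral m01 (integrable01 mu bf)) _.
  rewrite -Rintegral_cst//; apply: le_Rintegral => //.
    by apply: integrable_norm; exact: integrable01.
  exact: integrable01 (bounded_measurable01_cst M).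
by apply: lerD.
Qed.

(** Mesh 1/N comes with N+1 half-open cells: the last one starts at 1 and catches the right
    endpoint. *)
Definition cell (N : nat) (a : 'I_N.+1) : set R :=
  `[a%:R / N%:R, a.+1%:R / N%:R[%classic.

Definition node (N : nat) (a : 'I_N.+1) : R := a%:R / N%:R.

Definition weight l (N : nat) (a : 'I_N.+1) : R :=
  signed_integral l \1_(cell a).

Definition step (N : nat) (c : 'I_N.+1 -> R) (s : R) : R :=
  \sum_(a < N.+1) c a * \1_(cell a) s.

Lemma node01 (N : nat) (a : 'I_N.+1) : node a \in `[0, 1].
Proof.
rewrite in_itv/= /node divr_ge0//=.
case: N a => [|N] a; first by rewrite invr0 mulr0.
by rewrite ler_pdivrMr ?ltr0n// mul1r ler_nat -ltnS.
Qed.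

(** The cells are disjoint, and the one containing [s] has as index the integer part of [N * s],
    which is at most [N]. *)
Lemma stepE (N : nat) (c : 'I_N.+1 -> R) (s : R) : (0 < N)%N ->
  s \in `[0, 1] -> exists2 a : 'I_N.+1, step c s = c a &
    `|s - node a| < N%:R^-1.
Proof.
move=> N0; rewrite in_itv/= => /andP[s0 s1].
have N0' : 0 < N%:R :> R by rewrite ltr0n.
have Ns0 : 0 <= N%:R * s by rewrite mulr_ge0// ltW.
have /andP[h1 h2] := truncn_itv Ns0.
have kN : (Num.truncn (N%:R * s) < N.+1)%N.
  rewrite ltnS -(ler_nat R); apply: le_trans h1 _.
  by rewrite ler_piMr// ltW.
pose a := Ordinal kN.
have ain b : (s \in cell b) = (b == a).
  rewrite mem_setE in_itv/= ler_pdivrMr// ltr_pdivlMr// mulrC.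
  apply/idP/eqP => [/andP[b1 b2]|->]; last by rewrite h1 h2.
  apply/val_inj/eqP; rewrite eqn_leq.
  apply/andP; split; rewrite -ltnS -(ltr_nat R).
    exact: le_lt_trans b1 h2.
  exact: le_lt_trans h1 b2.
exists a.
  rewrite /step (bigD1 a)//= big1 ?addr0 => [|b ba].
    by rewrite indicE ain eqxx mulr1.
  by rewrite indicE ain (negbTE ba) mulr0.
rewrite /node/= ger0_norm.
  rewrite ltrBlDr -[X in X + _]mul1r -mulrDl ltr_pdivlMr// mulrC.
  by rewrite -natr1 addrC in h2.
by rewrite subr_ge0 ler_pdivrMr// [leRHS]mulrC.
Qed.

Lemma bounded_measurable01_step (N : nat) (c : 'I_N.+1 -> R) :
  bounded_measurable01 (step c).
Proof.
rewrite /step; elim: (index_enum _) => [|a r IH].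
  under eq_fun do rewrite big_nil; exact: bounded_measurable01_cst.
under eq_fun do rewrite big_cons; apply: bounded_measurable01D => //.
apply/bounded_measurable01Z/bounded_measurable01_indic.
exact: measurable_itv.
Qed.

Lemma signed_integral_step l (N : nat) (c : 'I_N.+1 -> R) :
  signed_integral l (step c) = \sum_(a < N.+1) c a * weight l a.
Proof.
rewrite /step.
(* The induction over the index list has to carry measurability along, because additivity of the
   integral asks for it at each term. *)
suff : bounded_measurable01 (step c) /\
  signed_integral l (step c) = \sum_(a < N.+1) c a * weight l a by case.
rewrite /step.
elim: (index_enum _) => [|a r [bm IH]].
  rewrite big_nil; under eq_fun do rewrite big_nil.
  split; first exact: bounded_measurable01_cst.
  rewrite /signed_integral !Rintegral_cst ?mul0r ?subrr//;
    exact: measurable_itv.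
rewrite big_cons -IH; under eq_fun do rewrite big_cons.
have b1 : bounded_measurable01 \1_(cell a).
  by apply: bounded_measurable01_indic; exact: measurable_itv.
split.
  by apply: bounded_measurable01D => //; exact: bounded_measurable01Z.
by rewrite signed_integralD ?signed_integralZ//; exact: bounded_measurable01Z.
Qed.

(** The sum is the integral of the step function that takes on each cell the value of [f] at the
    left end, and this function is within [e] of [f]. *)
Lemma signed_integral_weight l f (N : nat) (e : R) : (0 < N)%N ->
  bounded_measurable01 f ->
  (forall s t, s \in `[0, 1] -> t \in `[0, 1] -> `|s - t| < N%:R^-1 ->
     `|f s - f t| <= e) ->
  `|signed_integral l f - \sum_(a < N.+1) weight l a * f (node a)|
    <= e * mass01 l.
Proof.
move=> N0 bf fe; under eq_bigr do rewrite mulrC.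
rewrite -(signed_integral_step l (f \o @node N)) -mulN1r -signed_integralZ;
  last exact: bounded_measurable01_step.
have bs :=
  bounded_measurable01Z (-1) (bounded_measurable01_step (f \o @node N)).
rewrite -signed_integralD//; apply: signed_integral_le.
  exact: bounded_measurable01D.
move=> s s01; have [a -> sa] := stepE (f \o @node N) N0 s01.
by rewrite mulN1r; apply: fe => //; exact: node01.
Qed.

Lemma weight_le l (N : nat) (c : 'I_N.+1 -> R) (e : R) : (0 < N)%N ->
  (forall a, `|c a| <= e) ->
  `|\sum_(a < N.+1) weight l a * c a| <= e * mass01 l.
Proof.
move=> N0 ce; under eq_bigr do rewrite mulrC.
rewrite -signed_integral_step; apply: signed_integral_le.
  exact: bounded_measurable01_step.
by move=> s s01; have [a -> _] := stepE c N0 s01.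
Qed.

End SignedIntegral.

(** * The kernel inner product on signed measures *)

Section KernelDot.
Context (R : realType) (q : R -> R -> R).
Hypothesis q_cov : covariance_function01 q.
Implicit Types l : signed_measure R.

Lemma covariance_uniform_continuity (e : R) : 0 < e ->
  exists2 N : nat, (0 < N)%N & forall t t' s s',
    t \in `[0, 1] -> t' \in `[0, 1] -> s \in `[0, 1] -> s' \in `[0, 1] ->
    `|t - t'| < N%:R^-1 -> `|s - s'| < N%:R^-1 -> `|q t s - q t' s'| < e.
Proof.
have [qc _ _] := q_cov => e0.
have K : compact (`[0%R : R, 1%R : R] `*` `[0%R : R, 1%R : R]).
  by apply: compact_setX; exact: segment_compact.
have [d d0 H] := compact_uniform_continuity K qc e0.
have [N N0 Nd] : exists2 N : nat, (0 < N)%N & N%:R^-1 < d.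
  exists (Num.truncn d^-1).+1 => //.
  rewrite invf_plt ?posrE ?ltr0n//.
  by have /andP[] := truncn_itv (ltW (etrans (invr_gt0 d) d0)).
exists N => // t t' s s' t01 t'01 s01 s'01 tt' ss'.
apply: (H (t, s) (t', s')) => //=.
by split => /=; [exact: lt_trans tt' Nd | exact: lt_trans ss' Nd].
Qed.

Lemma covariance_within (t : R) : t \in `[0, 1] ->
  {within `[0, 1], continuous (q t)}.
Proof.
move=> t01; apply/within_continuousP => s s01 e e0.
have [N N0 H] := covariance_uniform_continuity e0.
exists N%:R^-1; first by rewrite invr_gt0 ltr0n.
by move=> s' s'01 ss'; apply: H => //; rewrite subrr normr0 invr_gt0 ltr0n.
Qed.

Lemma covariance_bounded_measurable (t : R) : t \in `[0, 1] ->
  bounded_measurable01 (q t).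
Proof.
by move=> t01; apply/bounded_measurable01_continuous/covariance_within.
Qed.

(** [N] is chosen before the measure, which enters only through its mass; this allows one grid for
    all measures. *)
Lemma measure_path_uniform_continuity (e : R) : 0 < e ->
  exists2 N : nat, (0 < N)%N & forall l t t',
    t \in `[0, 1] -> t' \in `[0, 1] -> `|t - t'| < N%:R^-1 ->
    `|measure_path q l t - measure_path q l t'| <= e * mass01 l.
Proof.
move=> e0; have [N N0 H] := covariance_uniform_continuity e0.
exists N => // l t t' t01 t'01 tt'.
have bt := covariance_bounded_measurable t01.
have bt' := bounded_measurable01Z (-1) (covariance_bounded_measurable t'01).
have -> : measure_path q l t - measure_path q l t' =
    signed_integral l (fun s => q t s + -1 * q t' s).
  rewrite signed_integralD// signed_integralZ ?mulN1r//.
  exact: covariance_bounded_measurable.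
apply: signed_integral_le; first exact: bounded_measurable01D.
move=> s s01; rewrite mulN1r; apply/ltW/H => //.
by rewrite subrr normr0 invr_gt0 ltr0n.
Qed.

Lemma measure_path_continuous l :
  {within `[0, 1], continuous (measure_path q l : R -> R)}.
Proof.
apply/within_continuousP => t t01 e e0.
have M0 : 0 < mass01 l + 1 by rewrite ltr_wpDl ?mass01_ge0.
have [N N0 H] := measure_path_uniform_continuity (divr_gt0 e0 M0).
exists N%:R^-1; first by rewrite invr_gt0 ltr0n.
move=> t' t'01 tt'; apply: le_lt_trans (H l t t' t01 t'01 tt') _.
by rewrite mulrAC ltr_pdivrMr// ltr_pM2l// ltrDl.
Qed.

Lemma measure_path_bounded_measurable l :
  bounded_measurable01 (measure_path q l : R -> R).
Proof. exact/bounded_measurable01_continuous/measure_path_continuous. Qed.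

Definition gram (N : nat) (v w : 'I_N.+1 -> R) : R :=
  \sum_(a < N.+1) v a * \sum_(b < N.+1) w b * q (node R a) (node R b).

(** First the outer and then the inner integral is replaced by a sum over the nodes, each at half of
    the error. One grid serves all pairs of measures, so several inner products can be discretized
    together. *)
Lemma measure_dot_gram (e : R) : 0 < e -> exists N : nat, forall l l',
  `|measure_dot q l l' - gram (@weight R l N) (@weight R l' N)|
    <= e * mass01 l * mass01 l'.
Proof.
move=> e0; have e20 : 0 < e / 2 by rewrite divr_gt0.
have [N1 N10 H1] := measure_path_uniform_continuity e20.
have [N2 N20 H2] := covariance_uniform_continuity e20.
pose N := maxn N1 N2; have N0 : (0 < N)%N by rewrite leq_max N10.
have NN1 : N%:R^-1 <= N1%:R^-1 :> R.
  by rewrite lef_pV2 ?posrE ?ltr0n// ler_nat leq_maxl.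
have NN2 : N%:R^-1 <= N2%:R^-1 :> R.
  by rewrite lef_pV2 ?posrE ?ltr0n// ler_nat leq_maxr.
exists N => l l'.
have A1 : `|measure_dot q l l' - \sum_(a < N.+1) weight l a *
    (measure_path q l' (node R a) : R)| <= e / 2 * mass01 l' * mass01 l.
  apply: signed_integral_weight => //.
    exact: measure_path_bounded_measurable.
  by move=> s t s01 t01 st; apply: H1 => //; exact: lt_le_trans st NN1.
have A2 : `|\sum_(a < N.+1) weight l a * ((measure_path q l' (node R a) : R) -
    \sum_(b < N.+1) weight l' b * q (node R a) (node R b))|
    <= e / 2 * mass01 l' * mass01 l.
  apply: weight_le => // a; apply: signed_integral_weight => //.
    by apply: covariance_bounded_measurable; exact: node01.
  move=> s t s01 t01 st; apply/ltW/H2 => //; try exact: node01.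
    by rewrite subrr normr0 invr_gt0 ltr0n.
  exact: lt_le_trans st NN2.
have -> : e * mass01 l * mass01 l' =
    e / 2 * mass01 l' * mass01 l + e / 2 * mass01 l' * mass01 l by field.
apply: le_trans (lerD A1 A2); apply: le_trans _ (ler_normD _ _).
rewrite le_eqVlt; apply/orP; left; apply/eqP; congr `|_|.
under [X in _ = _ + X]eq_bigr do rewrite mulrBr.
by rewrite sumrB addrA subrK.
Qed.

Lemma gram_sym (N : nat) (v w : 'I_N.+1 -> R) : gram v w = gram w v.
Proof.
have [_ qs _] := q_cov; rewrite /gram.
under eq_bigr do rewrite mulr_sumr; rewrite exchange_big/=.
apply: eq_bigr => b _; rewrite mulr_sumr; apply: eq_bigr => a _.
by rewrite (qs (node R a)) ?node01//; ring.
Qed.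

(** Finite-point positivity at the nodes with coefficients [a * v i + b * w i], expanded by
    symmetry. *)
Lemma gram_ge0 (N : nat) (v w : 'I_N.+1 -> R) (a b : R) :
  0 <= a ^+ 2 * gram v v + 2 * a * b * gram v w + b ^+ 2 * gram w w.
Proof.
have [_ _ /(_ N.+1 (@node R N) (fun i => a * v i + b * w i))] := q_cov.
move=> /(_ (@node01 R N)) /le_trans; apply.
rewrite le_eqVlt; apply/orP; left; apply/eqP.
have -> : 2 * a * b * gram v w = a * b * gram v w + a * b * gram w v.
  by rewrite (gram_sym w v); ring.
rewrite /gram !mulr_sumr -!big_split/=; apply: eq_bigr => i _.
rewrite !mulr_sumr -!big_split/=; apply: eq_bigr => j _; ring.
Qed.

(** Instead of exchanging the iterated integrals, both orders are compared with the same symmetric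
    Gram sum. *)
Lemma measure_dot_sym l l' : measure_dot q l l' = measure_dot q l' l.
Proof.
apply/eqP; rewrite -subr_eq0 -normr_le0; apply/ler_addgt0Pl => e e0.
set M := mass01 l * mass01 l'.
have M0 : 0 <= M by rewrite mulr_ge0// mass01_ge0.
(* This makes each of the two discretization errors at most [e / 2]; the added 1 keeps the divisor
   positive when a mass vanishes. *)
have d0 : 0 < e / 2 / (M + 1) by rewrite !divr_gt0// ltr_wpDl.
have [N H] := measure_dot_gram d0.
have h1 := H l l'; have h2 := H l' l; rewrite gram_sym in h2.
have le : e / 2 / (M + 1) * mass01 l * mass01 l' <= e / 2.
  rewrite -mulrA -/M mulrAC ler_pdivrMr ?ltr_wpDl//.
  by rewrite ler_pM2l ?divr_gt0// lerDl.
have le' : e / 2 / (M + 1) * mass01 l' * mass01 l <= e / 2 by rewrite mulrAC.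
move: (le_trans h1 le) (le_trans h2 le') => {h1 h2 le le'}.
by rewrite !ler_norml => /andP[? ?] /andP[? ?]; apply/andP; split; lra.
Qed.

(** The limit of [gram_ge0] along finer grids. The quadratic form in [a] and [b] expresses
    positivity on combinations of [l] and [l'] without building them as signed measures. *)
Lemma measure_dot_psd l l' (a b : R) :
  0 <= a ^+ 2 * measure_dot q l l + 2 * a * b * measure_dot q l l' +
       b ^+ 2 * measure_dot q l' l'.
Proof.
apply/ler_addgt0Pr => e e0.
set M := a ^+ 2 * (mass01 l * mass01 l) +
  `|2 * a * b| * (mass01 l * mass01 l') + b ^+ 2 * (mass01 l' * mass01 l').
have M0 : 0 <= M.
  by do ?apply: addr_ge0; apply: mulr_ge0;
    rewrite ?sqr_ge0// mulr_ge0 ?mass01_ge0.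
have d0 : 0 < e / (M + 1) by rewrite divr_gt0// ltr_wpDl.
have [N H] := measure_dot_gram d0.
have H' k k' c :
    c * gram (@weight R k N) (@weight R k' N) - c * measure_dot q k k' <=
    `|c| * (mass01 k * mass01 k') * (e / (M + 1)).
  rewrite -mulrBr; apply: le_trans (ler_norm _) _; rewrite normrM -mulrA.
  by rewrite ler_wpM2l// distrC mulrC mulrA.
have h1 := H' l l (a ^+ 2); have h2 := H' l l' (2 * a * b).
have h3 := H' l' l' (b ^+ 2).
rewrite !(ger0_norm (sqr_ge0 _)) in h1 h3.
have h := gram_ge0 (@weight R l N) (@weight R l' N) a b.
have le : M * (e / (M + 1)) <= e.
  by rewrite mulrCA ler_piMr ?(ltW e0)// ler_pdivrMr ?ltr_wpDl// mul1r lerDl.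
move: h1 h2 h3 h le; move: (e / _) => d; rewrite /M; lra.
Qed.

Lemma measure_dot_ge0 l : 0 <= measure_dot q l l.
Proof. by have := measure_dot_psd l l 1 0; rewrite expr1n expr0n/=; lra. Qed.

Lemma measure_dot_dist_ge0 l l' :
  0 <= measure_dot q l l - 2 * measure_dot q l l' + measure_dot q l' l'.
Proof. by have := measure_dot_psd l l' 1 (-1); rewrite sqrrN !expr1n; lra. Qed.

Lemma cauchy_schwarz_measure_dot l l' :
  measure_dot q l l' ^+ 2 <= measure_dot q l l * measure_dot q l' l'.
Proof.
set A := measure_dot q l l; set B := measure_dot q l l'.
set C := measure_dot q l' l'.
have H a b : 0 <= a ^+ 2 * A + 2 * a * b * B + b ^+ 2 * C.
  exact: measure_dot_psd.
have : 0 <= C by exact: measure_dot_ge0.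
rewrite le_eqVlt => /predU1P[C0|C0].
  have [->|B0] := eqVneq B 0; first by rewrite expr0n/= -C0 mulr0.
  (* When [C = 0] the form is affine in its second coefficient, and for nonzero [B] this choice
     gives it the value -1. *)
  have := H 1 (- (A + 1) / (2 * B)); rewrite -C0 mulr0 addr0 expr1n mul1r.
  have -> : 2 * 1 * (- (A + 1) / (2 * B)) * B = - (A + 1) by field.
  lra.
(* At [(C, -B)] the form equals [C * (A * C - B ^+ 2)], which gives the claim for positive [C]. *)
have := H C (- B); have -> : C ^+ 2 * A + 2 * C * - B * B + (- B) ^+ 2 * C =
  C * (A * C - B ^+ 2) by ring.
by rewrite pmulr_rge0// subr_ge0.
Qed.

End KernelDot.

(** * Reproducing kernel Hilbert spaces *)

Section ScaledDirac.
Context (R : realType).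

Lemma normrDl_ge0 (c : R) : 0 <= `|c| + c.
Proof. by have := ler_norm (- c); rewrite normrN; lra. Qed.

(* The signed measure c delta_t, as the difference of (|c| + c) delta_t and
   |c| delta_t. *)
Definition scaled_dirac (c t : R) : signed_measure R :=
  (mscale (NngNum (normrDl_ge0 c)) (@dirac _ (measurableTypeR R) t R)
     : {finite_measure set (measurableTypeR R) -> \bar R},
   mscale (NngNum (normr_ge0 c)) (@dirac _ (measurableTypeR R) t R)
     : {finite_measure set (measurableTypeR R) -> \bar R}).

Lemma signed_integral_scaled_dirac (c t : R) (f : R -> R) : t \in `[0, 1] ->
  bounded_measurable01 f -> signed_integral (scaled_dirac c t) f = c * f t.
Proof.
move=> t01 bf.
have m01 : measurable (`[0%R, 1%R] : set (measurableTypeR R)).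
  exact: measurable_itv.
have dirac1 : @dirac _ (measurableTypeR R) t R `[0%R, 1%R]%classic = 1%E.
  by rewrite diracE mem_set.
(* The rule for integrating against a scaled measure is applied to nonnegative functions; a general
   [f] is reached by adding a bound [M] and subtracting the constant case. *)
wlog f0 : f bf / forall s, s \in `[0, 1] -> 0 <= f s => [wlog_ge0|].
  have [_ [M fM]] := bf.
  have bM := bounded_measurable01_cst M.
  have bMf := bounded_measurable01D bM bf.
  have := wlog_ge0 _ bMf; rewrite signed_integralD// (wlog_ge0 _ bM).
    rewrite mulrDr => H; apply: (addrI (c * M)); apply: H.
    by move=> s /fM; rewrite ler_norml => /andP[]; lra.
  by move=> s s01; apply: le_trans (fM s s01).
have H (k : {nonneg R}) :
    \int[mscale k (@dirac _ (measurableTypeR R) t R)]_(s in `[0, 1]) f s =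
    k%:num * f t.
  have mf : measurable_fun (`[0%R, 1%R] : set (measurableTypeR R)) (EFin \o f).
    by apply/measurable_EFinP; case: bf.
  rewrite /Rintegral ge0_integral_mscale//.
  by rewrite integral_dirac// dirac1 mul1e.
by rewrite /signed_integral !H/=; ring.
Qed.

End ScaledDirac.

Section Rkhs.
Context (R : realType) (q : R -> R -> R).
Hypothesis q_cov : covariance_function01 q.
Implicit Types l : signed_measure R.

Lemma measure_path_scaled_dirac (c t s : R) : t \in `[0, 1] -> s \in `[0, 1] ->
  measure_path q (scaled_dirac c t) s = c * q s t.
Proof.
move=> t01 s01; apply: signed_integral_scaled_dirac => //.
exact: covariance_bounded_measurable.
Qed.

Lemma measure_dot_scaled_dirac (c t : R) l : t \in `[0, 1] ->
  measure_dot q (scaled_dirac c t) l = c * measure_path q l t.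
Proof.
move=> t01; apply: signed_integral_scaled_dirac => //.
exact: measure_path_bounded_measurable.
Qed.

(** Uniform convergence passes under the integral because [l] has finite mass on [0,1]. *)
Lemma measure_dot_cvg l (k : nat -> signed_measure R) (k0 : signed_measure R) :
  (fun i => measure_path q (k i)) @ \oo --> measure_path q k0 ->
  measure_dot q l (k i) @[i --> \oo] --> measure_dot q l k0.
Proof.
move=> /path01_cvg_uniform H; apply/cvgrPdist_le => e e0.
have M0 : 0 < mass01 l + 1 by rewrite ltr_wpDl ?mass01_ge0.
apply: filterS (H _ (divr_gt0 e0 M0)) => i Hi.
have b0 := measure_path_bounded_measurable q_cov k0.
have b1 := measure_path_bounded_measurable q_cov (k i).
have b2 := bounded_measurable01Z (-1) b1.
rewrite -mulN1r -signed_integralZ// -signed_integralD//.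
have : e / (mass01 l + 1) * mass01 l <= e.
  by rewrite mulrAC ler_pdivrMr// ler_pM2l// lerDl.
apply: le_trans; apply: signed_integral_le; first exact: bounded_measurable01D.
by move=> t t01; rewrite mulN1r ltW// Hi.
Qed.

Lemma path01_cvg_pointwise (f : nat -> path01 R) (g : path01 R) (t : R) :
  f @ \oo --> g -> t \in `[0, 1] -> f i t @[i --> \oo] --> g t.
Proof.
move=> /path01_cvg_uniform H t01; apply/cvgrPdist_lt => e e0.
by apply: filterS (H e e0) => i; apply.
Qed.

(** The reverse triangle inequality for the seminorm of the kernel, in squared form. *)
Lemma measure_dot_sqrt_dist l l' :
  (Num.sqrt (measure_dot q l l) - Num.sqrt (measure_dot q l' l')) ^+ 2 <=
  measure_dot q l l - 2 * measure_dot q l l' + measure_dot q l' l'.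
Proof.
rewrite sqrrB !sqr_sqrtr ?measure_dot_ge0// lerD2r lerD2l lerN2.
rewrite -[leRHS]mulr_natl.
rewrite ler_pM2l// -sqrtrM ?measure_dot_ge0//.
apply: le_trans (ler_norm _) _; rewrite -sqrtr_sqr ler_wsqrtr//.
exact: cauchy_schwarz_measure_dot.
Qed.

Lemma rkhs_approx_sqnorm_cvg (k : nat -> signed_measure R) (h : path01 R) :
  rkhs_approx q k h ->
  exists v : R, measure_dot q (k i) (k i) @[i --> \oo] --> v.
Proof.
move=> [kC _]; pose r i := Num.sqrt (measure_dot q (k i) (k i)).
have /cvg_ex[/= v rv] : cvg (r @ \oo).
  apply/cauchy_cvgP/cauchy_exP => e e0.
  (* The Cauchy condition controls squared distances, hence the threshold [e ^+ 2]. *)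
  have [N HN] := kC _ (exprn_gt0 2 e0); exists (r N).
  exists N => // i /= Ni.
  rewrite /ball/= -(ltr_pXn2r (n := 2)) ?nnegrE ?(ltW e0)//.
  rewrite real_normK ?num_real//.
  apply: le_lt_trans (measure_dot_sqrt_dist _ _) _.
  have := HN N i (leqnn _) Ni.
  by rewrite (measure_dot_sym q_cov (k i) (k N)); lra.
have -> : (fun i => measure_dot q (k i) (k i)) = r \* r.
  by apply/funext => i /=; rewrite -expr2 sqr_sqrtr ?measure_dot_ge0.
by exists (v * v); exact: cvgM.
Qed.

(** Convergence of the squared norms makes the set defining [rkhs_sqnorm] nonempty, so [xget] does
    not fall back on its default 0. *)
Lemma rkhs_sqnormP (h : path01 R) : rkhs q h ->
  exists2 k, rkhs_approx q k h &
    measure_dot q (k i) (k i) @[i --> \oo] --> rkhs_sqnorm q h.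
Proof.
move=> [_ [k kh]]; have [v kv] := rkhs_approx_sqnorm_cvg kh.
rewrite /rkhs_sqnorm.
apply: (@xgetPex _ 0 [set v : R | exists2 l, rkhs_approx q l h &
  measure_dot q (l i) (l i) @[i --> \oo] --> v]).
by exists v, k.
Qed.

(** Evaluation at [t] is the inner product with the unit mass at [t]: Cauchy-Schwarz holds along an
    approximating sequence and passes to the limit. *)
Lemma rkhs_reproducing_le (h : path01 R) (t : R) : rkhs q h ->
  t \in `[0, 1] -> h t ^+ 2 <= q t t * rkhs_sqnorm q h.
Proof.
move=> /rkhs_sqnormP[k [_ kh] kv] t01.
have kt := path01_cvg_pointwise kh t01.
rewrite expr2.
have c1 : (fun i => measure_path q (k i) t * measure_path q (k i) t) @ \oo -->
  h t * h t by exact: cvgM.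
have c2 : (fun i => q t t * measure_dot q (k i) (k i)) @ \oo -->
  q t t * rkhs_sqnorm q h by apply: cvgM kv; exact: cvg_cst.
apply: (ler_cvg_to c1 c2).
apply: nearW => i /=; rewrite -expr2.
have := cauchy_schwarz_measure_dot q_cov (scaled_dirac 1 t) (k i).
by rewrite !measure_dot_scaled_dirac// measure_path_scaled_dirac// !mul1r.
Qed.

Lemma rkhs_approx_measure_path l : rkhs_approx q (fun=> l) (measure_path q l).
Proof.
split; last exact: cvg_cst.
by move=> e e0; exists 0%N => i j _ _; rewrite subrr sub0r addNr.
Qed.

Lemma rkhs_measure_path l : rkhs q (measure_path q l).
Proof.
split; first exact: measure_path_continuous.
by exists (fun=> l); exact: rkhs_approx_measure_path.
Qed.

(* An approximating sequence [k] of the path of [l] satisfies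
   <k_i, k_j> -> <k_i, l> as j -> oo, so the Cauchy property bounds
   |k_i|^2 - 2 <k_i, l> + lim |k_j|^2 by e, and this tends to
   2 (lim |k_j|^2 - |l|^2) as i -> oo. *)
Lemma rkhs_sqnorm_measure_path l :
  rkhs_sqnorm q (measure_path q l) = measure_dot q l l.
Proof.
have [k [kC kl] kv] := rkhs_sqnormP (rkhs_measure_path l).
set v := rkhs_sqnorm _ _ in kv *.
have kll : measure_dot q (k i) l @[i --> \oo] --> measure_dot q l l.
  by under eq_fun do rewrite measure_dot_sym//; exact: measure_dot_cvg.
have limD w : (fun i => measure_dot q (k i) (k i) - 2 * measure_dot q (k i) l
    + w) @ \oo --> v - 2 * measure_dot q l l + w.
  apply: cvgD; last exact: cvg_cst.
  by apply: cvgB => //; apply: cvgM => //; exact: cvg_cst.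
(* The squared distances from [k i] to [l] are nonnegative and tend to [v] minus the squared norm of
   [l]. *)
have lower : measure_dot q l l <= v.
  have : 0 <= v - 2 * measure_dot q l l + measure_dot q l l.
    apply: (ler_cvg_to (cvg_cst 0) (limD _)).
    by apply: nearW => i; exact: measure_dot_dist_ge0.
  lra.
apply/eqP; rewrite eq_le lower andbT.
  apply/ler_addgt0Pr => e e0.
  have [N HN] := kC _ e0.
  have H i : (N <= i)%N ->
      measure_dot q (k i) (k i) - 2 * measure_dot q (k i) l + v <= e.
    move=> Ni.
    have c2 : (fun j => measure_dot q (k i) (k i)
        - 2 * measure_dot q (k i) (k j) + measure_dot q (k j) (k j)) @ \oo -->
        measure_dot q (k i) (k i) - 2 * measure_dot q (k i) l + v.
      apply: cvgD kv; apply: cvgB; first exact: cvg_cst.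
      by apply: cvgM; [exact: cvg_cst | exact: measure_dot_cvg].
    apply: (ler_cvg_to c2 (cvg_cst e)).
    exists N => // j /= Nj; apply/ltW; have := HN i j Ni Nj.
    by rewrite (measure_dot_sym q_cov (k j) (k i)); lra.
  have : v - 2 * measure_dot q l l + v <= e.
    apply: (ler_cvg_to (limD v) (cvg_cst e)).
    by exists N => // i /= /H.
  lra.
Qed.

End Rkhs.

(** * The cost of reaching a level *)

Section BridgeCost.
Context (R : realType) (q : R -> R -> R).
Hypothesis q_cov : covariance_function01 q.

(** Cauchy-Schwarz for unit masses. At [a = 0] and [a = 1] it makes the kernel sections vanish, so
    adding a multiple of one to [m] preserves the pinned endpoints. *)
Lemma covariance_eq0 (a t : R) : a \in `[0, 1] -> t \in `[0, 1] ->
  q a a = 0 -> q a t = 0.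
Proof.
move=> a01 t01 qa.
have := cauchy_schwarz_measure_dot q_cov (scaled_dirac 1 a) (scaled_dirac 1 t).
rewrite !measure_dot_scaled_dirac// !measure_path_scaled_dirac// !mul1r qa.
rewrite mul0r.
by rewrite le_eqVlt ltNge sqr_ge0 orbF sqrf_eq0 => /eqP.
Qed.

Lemma covariance_diag_ge0 (a : R) : a \in `[0, 1] -> 0 <= q a a.
Proof.
move=> a01; have := measure_dot_ge0 q_cov (scaled_dirac 1 a).
by rewrite measure_dot_scaled_dirac// measure_path_scaled_dirac// !mul1r.
Qed.

Lemma rkhs_sqnorm_ge0 (h : path01 R) : rkhs q h -> 0 <= rkhs_sqnorm q h.
Proof.
move=> /(rkhs_sqnormP q_cov)[k _ kv]; apply: (ler_cvg_to (cvg_cst 0) kv).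
by apply: nearW => i; exact: measure_dot_ge0.
Qed.

Lemma rate_bridge_ge0 (m : R -> R) (x0 y : R) (h : path01 R) :
  (0 <= rate_bridge q m x0 y h)%E.
Proof.
rewrite /rate_bridge; case: asboolP => [[_ _ hq]|_]; last exact: leey.
by rewrite lee_fin mulr_ge0// rkhs_sqnorm_ge0.
Qed.

Hypotheses (q00 : q 0 0 = 0) (q11 : q 1 1 = 0).
Context (m : R -> R) (x0 y : R).
Hypothesis (m_cont : {within `[0, 1], continuous m}).
Hypotheses (m0 : m 0 = x0) (m1 : m 1 = y).

Lemma rate_bridge_reaching (b t : R) : t \in `[0, 1] ->
  q t t != 0 \/ m t = b ->
  exists h : path01 R, [/\ C01 h, h t = b &
    (rate_bridge q m x0 y h <= quotient0 ((b - m t) ^+ 2) (2 * q t t))%E].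
Proof.
(* If [q t t = 0], division by zero makes [c] equal to 0; the path is then [m] itself, which already
   passes through [b] at [t]. *)
move=> t01 qm; pose c := (b - m t) / q t t.
pose g := measure_path q (scaled_dirac c t).
have i0 : (0 : R) \in `[0, 1] by rewrite in_itv/= lexx ler01.
have i1 : (1 : R) \in `[0, 1] by rewrite in_itv/= lexx ler01.
exists (fun s => m s + g s); split.
- apply/subspace_continuousP => r r01; apply: cvgD.
    by have /subspace_continuousP := m_cont; exact.
  have /subspace_continuousP :=
    measure_path_continuous q_cov (l := scaled_dirac c t).
  exact.
- rewrite /g measure_path_scaled_dirac// /c.
  by case: qm => [q0|->]; [field | rewrite subrr !mul0r addr0].
- rewrite /rate_bridge.
  have -> : (fun s => m s + g s - m s) = g.
    by apply/funext => s; rewrite addrC addKr.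
  rewrite asboolT; last first.
    split; last exact: rkhs_measure_path.
      by rewrite /g measure_path_scaled_dirac// covariance_eq0// mulr0 addr0.
    by rewrite /g measure_path_scaled_dirac// covariance_eq0// mulr0 addr0.
  rewrite rkhs_sqnorm_measure_path// measure_dot_scaled_dirac//.
  rewrite measure_path_scaled_dirac// /quotient0 mulf_eq0 pnatr_eq0/=.
  case: eqVneq => [->|q0]; last first.
    by rewrite lee_fin le_eqVlt /c; apply/orP; left; apply/eqP; field.
  by rewrite !mulr0; case: ifP; rewrite ?lexx ?leey.
Qed.

(* The sign [s] is 1 for an upper barrier and -1 for a lower one. *)
Lemma rate_bridge_lower_bound (s b t : R) (h : path01 R) : t \in `[0, 1] ->
  `|s| = 1 -> 0 < s * (b - m t) -> 0 <= s * (h t - b) ->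
  (quotient0 ((b - m t) ^+ 2) (2 * q t t) <= rate_bridge q m x0 y h)%E.
Proof.
move=> t01 s1 bm hb; rewrite /rate_bridge.
case: asboolP => [[_ _ hq]|_]; last exact: leey.
set g := (fun s => _ : R) in hq *.
have := rkhs_reproducing_le q_cov hq t01.
have ss : s ^+ 2 = 1 by rewrite -real_normK ?num_real// s1 expr1n.
have bmg : (b - m t) ^+ 2 <= g t ^+ 2.
  have -> : (b - m t) ^+ 2 = (s * (b - m t)) ^+ 2 by rewrite exprMn ss mul1r.
  have -> : g t ^+ 2 = (s * (h t - m t)) ^+ 2 by rewrite exprMn ss mul1r.
  rewrite ler_pXn2r// ?nnegrE; lra.
have bm2 : 0 < (b - m t) ^+ 2.
  rewrite lt_def sqr_ge0 sqrf_eq0 andbT.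
  by apply: contraTneq bm => ->; rewrite mulr0 ltxx.
(* With zero variance at [t] the reproducing inequality would force [g t = 0], although [g t] is at
   least as large in absolute value as the positive gap between [b] and [m t]. *)
move=> gq; have qt0 : 0 < q t t.
  rewrite lt_def covariance_diag_ge0// andbT.
  apply: contraTneq gq => ->; rewrite mul0r -ltNge.
  exact: lt_le_trans bm2 bmg.
rewrite /quotient0 mulf_eq0 pnatr_eq0/= (gt_eqF qt0) lee_fin.
rewrite ler_pdivrMr ?mulr_gt0//; apply: le_trans bmg (le_trans gq _).
by rewrite le_eqVlt; apply/orP; left; apply/eqP; field.
Qed.

(** The intermediate value theorem on [0,t]. The mean need not stay between [x0] and [y], so it may
    meet the barrier level on its own. *)
Lemma bridge_mean_crossing (s b t : R) : t \in `[0, 1] -> `|s| = 1 ->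
  0 < s * (b - x0) -> s * (b - m t) <= 0 -> exists2 r, r \in `[0, 1] & m r = b.
Proof.
move=> + s1; rewrite in_itv/= => /andP[t0 t1] bx bm.
have mt : {within `[0, t], continuous m}.
  apply: continuous_subspaceW m_cont => r /=.
  by rewrite !in_itv/= => /andP[-> /le_trans]; exact.
have [|r] := IVT t0 mt (v := b).
  rewrite m0; have [s0|s0] := leP 0 s.
    rewrite ger0_norm// in s1; rewrite s1 in bx bm.
    have h1 : x0 <= b by lra.
    have h2 : b <= m t by lra.
    by rewrite ge_min le_max h1 h2 orbT.
  rewrite ltr0_norm// in s1; have {}s1 : s = -1 by lra.
  rewrite s1 in bx bm.
  have h1 : b <= x0 by lra.
  have h2 : m t <= b by lra.
  by rewrite ge_min le_max h1 h2 orbT.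
rewrite in_itv/= => /andP[r0 rt] mr; exists r => //.
by rewrite in_itv/= r0 (le_trans rt).
Qed.

(** Each time yields a crossing path that costs at most its quotient, or else has quotient [+oo];
    each crossing path yields a time whose quotient is at most its cost. *)
Lemma rate_bridge_crossing (s b : R) : `|s| = 1 -> 0 < s * (b - x0) ->
  ereal_inf [set rate_bridge q m x0 y h | h in
    [set h : path01 R | C01 h /\
      exists2 t, t \in `[0, 1] & 0 <= s * (h t - b)]] =
  ereal_inf [set quotient0 ((b - m t) ^+ 2) (2 * q t t) | t in `[0, 1]].
Proof.
move=> s1 bx; apply/eqP; rewrite eq_le; apply/andP; split.
  apply: le_ereal_inf_tmp => _ [t t01 <-].
  have [[q0 mb]|qm] := pselect (q t t = 0 /\ m t <> b).
    rewrite /quotient0 q0 mulr0 eqxx sqrf_eq0 subr_eq0 eq_sym.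
    rewrite (negbTE (introN eqP mb)).
    exact: leey.
  have [|h [ch ht hJ]] := rate_bridge_reaching t01 (b := b).
    have [q0|?] := eqVneq (q t t) 0; [right|by left].
    by apply: contrapT => mb; apply: qm.
  apply: ereal_inf_le; exists (rate_bridge q m x0 y h) => //.
  by exists h => //; split => //; exists t => //; rewrite ht subrr mulr0.
apply: le_ereal_inf_tmp => _ [h [ch [t t01 ht]] <-].
have [bm|bm] := ltP 0 (s * (b - m t)).
  apply: ereal_inf_le; exists (quotient0 ((b - m t) ^+ 2) (2 * q t t)).
    by exists t.
  exact: rate_bridge_lower_bound ht.
(* Here the mean reaches [b] at some [r], where the quotient is 0 under either branch of its
   definition. *)
have [r r01 mr] := bridge_mean_crossing t01 s1 bx bm.
apply: (@le_trans _ _ 0%E); last exact: rate_bridge_ge0.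
apply: ereal_inf_le; exists (quotient0 ((b - m r) ^+ 2) (2 * q r r)).
  by exists r.
by rewrite /quotient0 mr subrr expr0n/= eqxx mul0r; case: ifP.
Qed.

Lemma C01D_cst (h : path01 R) (b : R) :
  C01 h -> C01 ((fun t => h t + b) : path01 R).
Proof.
move=> /subspace_continuousP ch; apply/subspace_continuousP => t t01.
by apply: cvgD; [exact: ch | exact: cvg_cst].
Qed.

(** The extreme value theorem supplies both the upper bound that [sup] needs to be meaningful and a
    time at which it is attained. *)
Lemma sup_path01_ge0 (h : path01 R) : C01 h ->
  0 <= sup [set h t | t in `[0, 1]] <-> exists2 t, t \in `[0, 1] & 0 <= h t.
Proof.
move=> ch; have [c c01 hc] := EVT_max ler01 ch; split.
  move=> sup0; exists c => //; apply: le_trans sup0 _; apply: ge_sup.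
    by exists (h c), c.
  by move=> _ [t t01 <-]; exact: hc.
move=> [t t01 ht]; apply: le_trans ht _; apply: ub_le_sup; last by exists t.
by exists (h c) => _ [r r01 <-]; exact: hc.
Qed.

Lemma inf_path01_le0 (h : path01 R) : C01 h ->
  inf [set h t | t in `[0, 1]] <= 0 <-> exists2 t, t \in `[0, 1] & h t <= 0.
Proof.
move=> ch; have [c c01 hc] := EVT_min ler01 ch; split.
  move=> inf0; exists c => //; apply: le_trans inf0; apply: lb_le_inf.
    by exists (h c), c.
  by move=> _ [t t01 <-]; exact: hc.
move=> [t t01 ht]; apply: le_trans ht; apply: ge_inf; last by exists t.
by exists (h c) => _ [r r01 <-]; exact: hc.
Qed.

(** Translation by [b] carries [Gamma] onto the paths that reach or pass the level [b]; the sign [s]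
    treats both barriers at once. *)
Lemma crossing_costE (J : path01 R -> \bar R) (s b : R)
    (Gamma : set (path01 R)) :
  (forall h : path01 R, Gamma h <->
     C01 h /\ exists2 t, t \in `[0, 1] & 0 <= s * h t) ->
  crossing_cost J Gamma b = ereal_inf [set J h | h in
    [set h : path01 R | C01 h /\
      exists2 t, t \in `[0, 1] & 0 <= s * (h t - b)]].
Proof.
move=> HG; congr ereal_inf; apply/seteqP; split=> v [h].
  move=> /HG[ch [t t01 ht]] <-; exists (fun t => h t + b) => //.
  by split; [exact: C01D_cst | exists t => //; rewrite addrK].
move=> [ch [t t01 ht]] <-; exists (fun t => h t + - b).
  by apply/HG; split; [exact: C01D_cst | exists t].
by congr J; apply/funext => r; rewrite subrK.
Qed.

Lemma crossing_cost_upper (b : R) : x0 < b ->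
  crossing_cost (rate_bridge q m x0 y) (@Gamma_upper R) b =
  ereal_inf [set quotient0 ((b - m t) ^+ 2) (2 * q t t) | t in `[0, 1]].
Proof.
move=> xb; rewrite -(rate_bridge_crossing (s := 1)) ?normr1 ?mul1r ?subr_gt0//.
apply: crossing_costE => h; split=> -[ch].
  move=> /(sup_path01_ge0 ch)[t t01 ht]; split=> //.
  by exists t; rewrite ?mul1r.
move=> [t t01]; rewrite mul1r => ht; split => //.
by apply/(sup_path01_ge0 ch); exists t.
Qed.

Lemma crossing_cost_lower (b : R) : b < x0 ->
  crossing_cost (rate_bridge q m x0 y) (@Gamma_lower R) b =
  ereal_inf [set quotient0 ((b - m t) ^+ 2) (2 * q t t) | t in `[0, 1]].
Proof.
move=> xb; rewrite -(rate_bridge_crossing (s := -1)) ?normrN1//; last first.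
  by rewrite mulN1r opprB subr_gt0.
apply: crossing_costE => h; split=> -[ch].
  move=> /(inf_path01_le0 ch)[t t01 ht]; split=> //; exists t => //.
  by rewrite mulN1r oppr_ge0.
move=> [t t01]; rewrite mulN1r oppr_ge0 => ht; split => //.
by apply/(inf_path01_le0 ch); exists t.
Qed.

End BridgeCost.

(** * Logarithmic asymptotics of unions *)

Section LogProbability.
Local Open Scope ereal_scope.

(** For equal limits, the maximum is at each point one of two values near the common limit; for
    distinct limits, a real number between them eventually separates the functions. Infinite limits
    are covered because a cost may be infinite. *)
Lemma cvge_maxe (T : Type) (F : set_system T) {FF : Filter F} (R : realType)
    (f g : T -> \bar R) (a b : \bar R) :
  f @ F --> a -> g @ F --> b -> (fun x => maxe (f x) (g x)) @ F --> maxe a b.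
Proof.
wlog : f g a b / a <= b => [H fa gb|].
  have /orP[ab|ba] := le_total a b; first exact: H.
  have -> : (fun x => maxe (f x) (g x)) = (fun x => maxe (g x) (f x)).
    by apply/funext => x; rewrite maxC.
  by rewrite maxC; exact: H.
move=> ab fa gb; rewrite max_r//.
move: ab; rewrite le_eqVlt => /predU1P[ab|ab].
  move=> A bA; have fA : F (f @^-1` A) by apply: fa; rewrite ab.
  have gA : F (g @^-1` A) by apply: gb.
  change (F ((fun x => maxe (f x) (g x)) @^-1` A)).
  apply: filterS2 fA gA => x /= fx gx.
  by have /orP[h|h] := le_total (f x) (g x); rewrite ?(max_r h) ?(max_l h).
have [r ar rb] : exists2 r : R, a < r%:E & r%:E < b.
  move: a b ab {fa gb} => [a| |] [b| |]//; rewrite ?lte_fin => ab.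
  - by exists ((a + b) / 2)%R; rewrite lte_fin; lra.
  - by exists (a + 1)%R; rewrite ?lte_fin ?ltry//; lra.
  - by exists (b - 1)%R; rewrite ?lte_fin ?ltNyr//; lra.
  - by exists 0%R; rewrite ?ltNyr ?ltry.
have fr : F [set x | f x < r%:E].
  apply: (fa [set y | y < r%:E]); apply: open_nbhs_nbhs; split=> //.
  exact: open_ereal_lt_ereal.
have gr : F [set x | r%:E < g x].
  apply: (gb [set y | r%:E < y]); apply: open_nbhs_nbhs; split=> //.
  exact: open_ereal_gt_ereal.
move=> A /gb gA; change (F ((fun x => maxe (f x) (g x)) @^-1` A)).
change (F (g @^-1` A)) in gA; apply: filterS3 fr gr gA => x /= fx gx.
by rewrite max_r// ltW// (lt_trans fx gx).
Qed.

Lemma lneD_le (R : realType) (p r : \bar R) : 0 <= p <= 1 -> 0 <= r <= 1 ->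
  lne (p + r) <= maxe (lne p) (lne r) + (ln 2)%:E.
Proof.
wlog pr : p r / p <= r.
  move=> H p0 r0; have /orP[?|?] := le_total p r; first exact: H.
  by rewrite (addeC p) (maxC (lne p)); apply: H.
move=> /andP[p0 p1] /andP[r0 r1].
apply: (@le_trans _ _ (lne r + (ln 2)%:E)); last first.
  by rewrite leeD2r// le_max lexx orbT.
(* At [r = 0] the left side is the logarithm of 0, that is [-oo]; the product rule used below needs
   positive factors. *)
have [r00|r00] := eqVneq r 0.
  have -> : p = 0 by apply/eqP; rewrite eq_le p0 andbT -r00.
  by rewrite r00 adde0 le0_lneNy.
have rgt0 : 0 < r by rewrite lt_def r00.
rewrite -lne_EFin// -lneM ?in_itv/= ?rgt0 ?leey ?lte_fin ?ltr0n//.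
rewrite lee_lne ?in_itv/= ?leey ?andbT ?adde_ge0 ?mule_ge0//.
by rewrite muleC mule_natl mule2n leeD2r.
Qed.

(** A squeeze: monotonicity gives the lower bound, subadditivity and [lneD_le] the upper one, and
    the two differ by [g e ^+ 2 * ln 2], which tends to 0. *)
Lemma log_probabilityU_cvg (d : measure_display) (Omega : measurableType d)
    (R : realType) (P : probability Omega R) (g : R -> R)
    (A B : R -> set Omega) (a b : \bar R) :
  (forall e, (0 < e)%R -> measurable (A e)) ->
  (forall e, (0 < e)%R -> measurable (B e)) ->
  g e @[e --> 0^'+] --> (0 : R)%R ->
  log_probability P g A e @[e --> 0^'+] --> a ->
  log_probability P g B e @[e --> 0^'+] --> b ->
  log_probability P g (fun e => A e `|` B e) e @[e --> 0^'+] --> maxe a b.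
Proof.
move=> mA mB g0 Aa Bb.
have maxAB : maxe (log_probability P g A e) (log_probability P g B e)
  @[e --> 0^'+] --> maxe a b by exact: cvge_maxe.
have up : maxe (log_probability P g A e) (log_probability P g B e) +
   (g e ^+ 2 * ln 2)%:E @[e --> 0^'+] --> maxe a b.
  rewrite -[X in _ --> X]adde0; apply: cvgeD => //.
    by rewrite fin_num_adde_defl.
  apply/fine_cvgP; split; first exact: nearW.
  have g2 : (g e * g e * ln 2)%R @[e --> 0^'+] --> ((0 : R) * 0 * ln 2)%R.
    by apply: cvgM; [exact: cvgM | exact: cvg_cst].
  by rewrite !mul0r in g2.
apply: squeeze_cvge maxAB up.
near=> e.
have e0 : (0 < e)%R by near: e; exact: nbhs_right_gt.
have mAe := mA e e0; have mBe := mB e e0.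
have mAB : measurable (A e `|` B e) by exact: measurableU.
have g2 : 0 <= (g e ^+ 2)%:E by rewrite lee_fin sqr_ge0.
have mono C D : measurable C -> measurable D -> C `<=` D ->
    (g e ^+ 2)%:E * lne (P C) <= (g e ^+ 2)%:E * lne (P D).
  move=> mC mD CD; rewrite lee_wpmul2l// lee_lne ?in_itv/= ?leey ?andbT//.
  by apply: le_measure; rewrite ?inE.
apply/andP; split.
  by rewrite ge_max; apply/andP; split; apply: mono => //.
apply: (@le_trans _ _ ((g e ^+ 2)%:E * lne (P (A e) + P (B e)))).
  rewrite lee_wpmul2l// lee_lne ?in_itv/= ?leey ?andbT ?adde_ge0//.
  exact: measureU2.
apply: (@le_trans _ _ ((g e ^+ 2)%:E *
    (maxe (lne (P (A e))) (lne (P (B e))) + (ln 2)%:E))).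
  by rewrite lee_wpmul2l// lneD_le ?measure_ge0 ?probability_le1.
rewrite muleDr// ?fin_num_adde_defl// EFinM leeD2r//.
by have /orP[h|h] := le_total (lne (P (A e))) (lne (P (B e)));
  rewrite ?(max_r h) ?(max_l h) le_max lexx ?orbT.
Unshelve. all: by end_near. Qed.

End LogProbability.

(** * Measurability of hitting events *)

Section HittingTime.
Context (R : realType) (d : measure_display) (Omega : measurableType d).
Variable F : R -> Omega -> R.
Hypothesis F_meas : forall t, measurable_fun setT (F t).
Hypothesis F_cont : forall w, {within `[0, +oo[, continuous (F ^~ w)}.

Let F_continuous (w : Omega) (t e : R) : 0 <= t -> 0 < e ->
  exists2 r : R, 0 < r &
    forall s, 0 <= s -> `|t - s| < r -> `|F t w - F s w| < e.
Proof.
move=> t0 e0; have /within_continuousP := @F_cont w => /(_ t _ e e0)[].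
  by rewrite /= in_itv/= t0.
move=> r r0 Hr; exists r => // s s0 ts; apply: Hr => //.
by rewrite /= in_itv/= s0.
Qed.

(** Both barriers reduce to this zero level, with [F] the process minus [U], or [L] minus the
    process. *)
Definition hitting_time (w : Omega) : \bar R :=
  ereal_inf [set t%:E | t in [set t : R | 0 < t /\ 0 <= F t w]].

(** The infimum could equal 1 through times decreasing to 1. Without a hit in (0,1], however,
    [F 1 w] is negative, and continuity keeps the next hit at least [r] away. *)
Lemma hitting_time_le1 (w : Omega) :
  (hitting_time w <= 1)%E <->
  exists2 t : R, 0 < t <= 1 & 0 <= F t w.
Proof.
split=> [|[t /andP[t0 t1] Ft]]; last first.
  by apply: ereal_inf_le; exists t%:E; rewrite ?lee_fin//; exists t.
apply: contraPP => noF; have F1 : F 1 w < 0.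
  rewrite ltNge; apply/negP => F1; apply: noF.
  by exists 1; rewrite ?ltr01 ?lexx.
have [|r r0 Hr] := F_continuous w ler01 (e := - F 1 w).
  by rewrite oppr_gt0.
apply/negP; rewrite -ltNge.
apply: (@lt_le_trans _ _ (1 + r)%:E); first by rewrite lte_fin ltrDl.
apply: le_ereal_inf_tmp => _ [t [t0 Ft] <-].
rewrite lee_fin leNgt; apply/negP => tr.
have [t1|t1] := leP t 1; first by apply: noF; exists t; rewrite ?t0.
have : `|1 - t| < r by rewrite ltr0_norm; lra.
by move=> /(Hr t (ltW t0)); rewrite ltr_norml => /andP[]; lra.
Qed.

(* By continuity and compactness of [c, 1], quantifying over the countably many
   points c + (1 - c) a / N suffices. *)
Lemma nonneg_on_itvP (c : R) (w : Omega) : 0 <= c <= 1 ->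
  (exists2 t : R, c <= t <= 1 & 0 <= F t w) <->
  (forall m : nat, exists N : nat, exists a : 'I_N.+1,
     - m.+1%:R^-1 < F (c + (1 - c) * node R a) w).
Proof.
move=> /andP[c0 c1]; split=> [[t /andP[ct t1] Ft] m|H].
  have t0 := le_trans c0 ct.
  have [|r r0 Hr] := F_continuous w t0 (e := m.+1%:R^-1).
    by rewrite invr_gt0 ltr0n.
  have [s s01 ts] : exists2 s, s \in `[0, 1] & t = c + (1 - c) * s.
    have [c1'|cn1] := eqVneq c 1.
      exists 0; first by rewrite in_itv/= lexx ler01.
      by rewrite mulr0 addr0; apply/eqP; rewrite eq_le ct andbT c1'.
    have c10 : 0 < 1 - c by rewrite subr_gt0 lt_neqAle cn1.
    exists ((t - c) / (1 - c)); last by field; rewrite gt_eqF.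
    rewrite in_itv/= divr_ge0 ?subr_ge0//=.
    by rewrite ler_pdivrMr// mul1r lerD2r.
  have N0 : (0 < (Num.truncn r^-1).+1)%N by [].
  have [a _ sa] := stepE (fun=> 0) N0 s01.
  exists (Num.truncn r^-1).+1, a.
  have n01 := node01 R a; rewrite in_itv/= in n01.
  have /andP[n0 n1] := n01.
  suff : `|F t w - F (c + (1 - c) * node R a) w| < m.+1%:R^-1.
    rewrite ltr_norml; move: (m.+1%:R^-1) => u /andP[]; lra.
  apply: Hr; first by rewrite addr_ge0// mulr_ge0// subr_ge0.
  have -> : t - (c + (1 - c) * node R a) = (1 - c) * (s - node R a).
    by rewrite ts; ring.
  rewrite normrM ger0_norm ?subr_ge0//.
  apply: (@le_lt_trans _ _ `|s - node R a|).
    by rewrite ler_piMl// lerBlDr lerDl.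
  apply: (lt_trans sa); rewrite invf_plt ?posrE ?ltr0n//.
  by have /andP[] := truncn_itv (ltW (etrans (invr_gt0 r) r0)).
have Fc : {within `[c, 1], continuous (F ^~ w)}.
  apply: continuous_subspaceW (@F_cont w) => t /=.
  by rewrite !in_itv/= andbT => /andP[/(le_trans c0)].
have [t t01 Ht] := EVT_max c1 Fc.
exists t; first by rewrite in_itv/= in t01.
rewrite leNgt; apply/negP => Ft.
have Ft' : 0 < - F t w by rewrite oppr_gt0.
(* This index makes the tolerance smaller than the distance from the negative maximum to 0, so that
   no grid value can exceed minus the tolerance. *)
have [N [a]] := H (Num.truncn (- F t w)^-1).
have n01 := node01 R a; rewrite in_itv/= in n01.
have /andP[n0 n1] := n01.
have /Ht : c + (1 - c) * node R a \in `[c, 1].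
  rewrite in_itv/= lerDl mulr_ge0 ?subr_ge0//=.
  by rewrite -lerBrDl ler_piMr// subr_ge0.
move=> h1 h2; have := lt_le_trans h2 h1; rewrite ltNge => /negP; apply.
rewrite lerNr; apply: ltW; rewrite invf_plt ?posrE ?ltr0n//.
by have /andP[] := truncn_itv (ltW (etrans (invr_gt0 (- F t w)) Ft')).
Qed.

(** The interval (0,1] is the countable union of the compact intervals [1/(n+1), 1], on each of
    which [nonneg_on_itvP] gives countably many conditions. *)
Lemma measurable_hitting_time_le1 :
  measurable [set w | (hitting_time w <= 1)%E].
Proof.
pose c (n : nat) : R := n.+1%:R^-1.
have c01 n : 0 <= c n <= 1.
  by rewrite /c invr_ge0 ler0n invf_le1 ?ltr0n// ler1n.
(* [inord] lets [a] range over all natural numbers, so that every union is indexed by [nat]. *)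
have -> : [set w | (hitting_time w <= 1)%E] =
    \bigcup_n \bigcap_m \bigcup_N \bigcup_a
      [set w | - m.+1%:R^-1 <
               F (c n + (1 - c n) * node R (inord a : 'I_N.+1)) w].
  apply/seteqP; split=> w /=.
    move=> /hitting_time_le1[t /andP[t0 t1] Ft].
    have ct : c (Num.truncn t^-1) <= t.
      apply: ltW; rewrite invf_plt ?posrE ?ltr0n//.
      by have /andP[] := truncn_itv (ltW (etrans (invr_gt0 t) t0)).
    exists (Num.truncn t^-1) => // m _.
    have [+ _] := nonneg_on_itvP w (c01 (Num.truncn t^-1)).
    have {}Ft : exists2 s : R, c (Num.truncn t^-1) <= s <= 1 & 0 <= F s w.
      by exists t; rewrite ?ct.
    move=> /(_ Ft m).
    by move=> [N [a Ha]]; exists N => //; exists a => //=; rewrite inord_val.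
  move=> [n _ Hn]; apply/hitting_time_le1.
  have [_ [m|t /andP[ct t1] Ft]] := nonneg_on_itvP w (c01 n).
    by have [N _ [a _ Ha]] := Hn m I; exists N, (inord a).
  exists t => //; rewrite t1 andbT; apply: lt_le_trans ct.
  by rewrite invr_gt0 ltr0n.
apply: bigcupT_measurable => n; apply: bigcapT_measurable => m.
apply: bigcupT_measurable => N; apply: bigcupT_measurable => a.
have := @F_meas (c n + (1 - c n) * node R (inord a : 'I_N.+1)) measurableT _
  (measurable_itv `]- m.+1%:R^-1, +oo[).
rewrite setTI; congr measurable; apply/seteqP; split=> w /=;
  by rewrite in_itv/= andbT.
Qed.

End HittingTime.

(** * Continuity and measurability of the conditioned processes *)

Section ConditionalProcess.
Context (R : realType).

(** The common shape of one conditioning step for covariances, processes and the bridge, as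
    functions of [t]. *)
Lemma within_continuousBM (K : set R) (f g : R -> R) (c a : R) :
  {within K, continuous f} -> {within K, continuous g} ->
  {within K, continuous (fun t => f t - g t / c * a)}.
Proof.
move=> /subspace_continuousP cf /subspace_continuousP cg.
apply/subspace_continuousP => t Kt; apply: cvgB; first exact: cf.
by do 2![apply: cvgM; last exact: cvg_cst]; exact: cg.
Qed.

Lemma within_continuous_affine (f : R -> R) (T0 e : R) : 0 <= T0 -> 0 < e ->
  {within `[0, +oo[, continuous f} ->
  {within `[0, +oo[, continuous (fun t => f (T0 + e * t))}.
Proof.
move=> T00 e0 /within_continuousP cf; apply/within_continuousP => t.
have K u : 0 <= u -> `[0, +oo[%classic (T0 + e * u).
  by move=> u0; rewrite /= in_itv/= andbT addr_ge0// mulr_ge0// ltW.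
rewrite /= in_itv/= andbT => t0 r r0.
have [d d0 Hd] := cf _ (K t t0) r r0.
exists (d / e); first by rewrite divr_gt0.
move=> s; rewrite /= in_itv/= andbT => s0 ts; apply: Hd; first exact: K.
rewrite opprD addrACA subrr add0r -mulrBr normrM gtr0_norm//.
by rewrite mulrC -ltr_pdivlMr.
Qed.

Context (k : R -> R -> R) (T x : nat -> R).
Hypothesis k_cont : {within `[0, +oo[ `*` `[0, +oo[,
     continuous (fun p : R * R => k p.1 p.2)}.

Lemma covariance_section_continuous (s : R) : 0 <= s ->
  {within `[0, +oo[, continuous (k ^~ s)}.
Proof.
move=> s0; apply/within_continuousP => t t0 e e0.
have /subspace_continuousP/(_ (t, s)) := k_cont.
have Ks : `[0, +oo[%classic s by rewrite /= in_itv/= s0.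
move=> /(_ (conj t0 Ks)) /cvgrPdist_lt /(_ e e0); rewrite near_withinE.
move=> /nbhs_ballP[d /= d0 Hd]; exists d => // r Kr tr.
by apply: (Hd (r, s)) => //; split => //; exact: ballxx.
Qed.

(** The induction keeps [s] general, since each step also involves the section at the new
    conditioning time. *)
Lemma conditional_covariance_continuous (j : nat) (s : R) :
  (forall i, (1 <= i <= j)%N -> 0 <= T i) -> 0 <= s ->
  {within `[0, +oo[, continuous (conditional_covariance k T j ^~ s)}.
Proof.
elim: j s => [|j IH] s Tge0 s0; first exact: covariance_section_continuous.
have Tge0' i : (1 <= i <= j)%N -> 0 <= T i.
  by move=> /andP[i1 ij]; apply: Tge0; rewrite i1 ltnW.
apply: within_continuousBM; first exact: IH.
by apply: IH => //; apply: Tge0; rewrite leqnn.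
Qed.

Lemma conditional_process_continuous (Omega : Type) (X : R -> Omega -> R)
    (j : nat) (w : Omega) :
  (forall i, (1 <= i <= j)%N -> 0 <= T i) ->
  {within `[0, +oo[, continuous (X ^~ w)} ->
  {within `[0, +oo[, continuous (conditional_process X k T x j ^~ w)}.
Proof.
move=> + Xc; elim: j => [//|j IH] Tge0.
have Tge0' i : (1 <= i <= j)%N -> 0 <= T i.
  by move=> /andP[i1 ij]; apply: Tge0; rewrite i1 ltnW.
apply: within_continuousBM; first exact: IH.
by apply: conditional_covariance_continuous => //; apply: Tge0; rewrite leqnn.
Qed.

Lemma conditional_process_measurable (d : measure_display)
    (Omega : measurableType d) (X : R -> Omega -> R) (j : nat) (t : R) :
  (forall t, measurable_fun setT (X t)) ->
  measurable_fun setT (conditional_process X k T x j t).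
Proof.
move=> mX; elim: j t => [|j IH] t; first exact: mX.
apply: measurable_funB => //; apply: measurable_funM => //.
exact: measurable_funB.
Qed.

End ConditionalProcess.

(** * Measurability of the barrier events *)

Section HittingEvents.
Context (R : realType) (d : measure_display) (Omega : measurableType d).
Context (Z : R -> Omega -> R) (T0 e : R).
Hypotheses (Z_meas : forall t, measurable_fun setT (Z t))
  (Z_cont : forall w, {within `[0, +oo[, continuous (Z ^~ w)})
  (T0_ge0 : 0 <= T0) (e_gt0 : 0 < e).

Lemma measurable_hit_upper_le1 (U : R -> R) :
  {within `[0, +oo[, continuous U} ->
  measurable [set w | (hit_upper Z U T0 e w <= 1)%E].
Proof.
move=> U_cont; pose F t w := Z (T0 + e * t) w - U (T0 + e * t).
have -> : hit_upper Z U T0 e = hitting_time F.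
  apply/funext => w; rewrite /hit_upper /hitting_time; congr ereal_inf.
  by congr image; apply/seteqP; split=> t /=; rewrite subr_ge0.
apply: measurable_hitting_time_le1 => [t|w].
  by apply: measurable_funB => //; exact: measurable_cst.
have cZ := within_continuous_affine T0_ge0 e_gt0 (@Z_cont w).
have cU := within_continuous_affine T0_ge0 e_gt0 U_cont.
apply/subspace_continuousP => t t0; apply: cvgB.
  by have /subspace_continuousP := cZ; exact.
by have /subspace_continuousP := cU; exact.
Qed.

Lemma measurable_hit_lower_le1 (L : R -> R) :
  {within `[0, +oo[, continuous L} ->
  measurable [set w | (hit_lower Z L T0 e w <= 1)%E].
Proof.
move=> L_cont; pose F t w := L (T0 + e * t) - Z (T0 + e * t) w.
have -> : hit_lower Z L T0 e = hitting_time F.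
  apply/funext => w; rewrite /hit_lower /hitting_time; congr ereal_inf.
  by congr image; apply/seteqP; split=> t /=; rewrite subr_ge0.
apply: measurable_hitting_time_le1 => [t|w].
  by apply: measurable_funB => //; exact: measurable_cst.
have cZ := within_continuous_affine T0_ge0 e_gt0 (@Z_cont w).
have cL := within_continuous_affine T0_ge0 e_gt0 L_cont.
apply/subspace_continuousP => t t0; apply: cvgB.
  by have /subspace_continuousP := cL; exact.
by have /subspace_continuousP := cZ; exact.
Qed.

End HittingEvents.

(** * The mean of the limit bridge *)

Section BridgeMean.
Context (R : realType) (q : R -> R -> R) (x0 y : R).

Lemma bridge_mean1 : q 1 1 != 0 -> bridge_mean q x0 y 1 = y.
Proof.
by move=> q1; rewrite /bridge_mean /regression divff// mul1r addrC subrK.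
Qed.

Lemma bridge_mean_continuous : covariance_function01 q ->
  {within `[0, 1], continuous (bridge_mean q x0 y)}.
Proof.
move=> q_cov.
have cq : {within `[0, 1], continuous (q ^~ 1)}.
  apply/within_continuousP => t t01 e e0.
  have [N N0 H] := covariance_uniform_continuity q_cov e0.
  exists N%:R^-1; first by rewrite invr_gt0 ltr0n.
  move=> s s01 ts; apply: H => //; rewrite ?in_itv/= ?lexx ?ler01//.
  by rewrite subrr normr0 invr_gt0 ltr0n.
apply/subspace_continuousP => t t01; apply: cvgD; first exact: cvg_cst.
do 2![apply: cvgM; last exact: cvg_cst].
by have /subspace_continuousP := cq; exact.
Qed.

End BridgeMean.

(* Otherwise the upper bound for the whole space would read 0 <= -oo. *)
Lemma LDP_finite_rate (d : measure_display) (Omega : measurableType d)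
    (R : realType) (P : probability Omega R) (V : R -> Omega -> path01 R)
    (g : R -> R) (J : path01 R -> \bar R) : LDP P V g J ->
  exists2 h : path01 R, C01 h & (J h < +oo)%E.
Proof.
move=> [_ _ _ /(_ setT closedT)].
have -> : log_probability P g (fun e => [set w | setT (V e w)]) = fun=> 0%E.
  apply/funext => e; rewrite /log_probability.
  have -> : [set w | setT (V e w)] = [set: Omega] by apply/seteqP.
  by rewrite probability_setT lne1 mule0.
move=> upper; apply: contrapT => nofin.
have : (+oo <= ereal_inf [set J h | h in setT `&` @C01 R])%E.
  apply: le_ereal_inf_tmp => _ [h [_ ch] <-]; rewrite leNgt; apply/negP => Jh.
  by apply: nofin; exists h.
rewrite leye_eq => /eqP infy; rewrite infy in upper.
have n0 : ~ (0 : R)^'+ set0 by exact: filter_not_empty.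
by have := le_trans (limf_esup_ge0 n0 (fun=> lexx 0%E)) upper.
Qed.

(* [kbar_n 0 0 = 0] is not assumed, so that [m 0 = x0] has to be read off the
   rate function: the paths of the RKHS vanish at 0. *)
Lemma rate_bridge_finite_start (R : realType) (q : R -> R -> R) (m : R -> R)
    (x0 y : R) (h : path01 R) : covariance_function01 q -> q 0 0 = 0 ->
  (rate_bridge q m x0 y h < +oo)%E -> m 0 = x0.
Proof.
move=> q_cov q00; rewrite /rate_bridge; case: asboolP => [[h0 _ hq] _|//].
have i0 : (0 : R) \in `[0, 1] by rewrite in_itv/= lexx ler01.
have := rkhs_reproducing_le q_cov hq i0.
rewrite q00 mul0r le_eqVlt ltNge sqr_ge0 orbF sqrf_eq0 subr_eq0 => /eqP <-.
exact: h0.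
Qed.

(** * Crossing costs and exit asymptotics for the bridge *)

Theorem proposition5p2 (R : realType) (d : measure_display)
  (Omega : measurableType d) (P : probability Omega R)
  (X : R -> {RV P >-> R}) (k : R -> R -> R)
  (X_gauss : centered_gaussian_process X)
  (X_cont : forall w, {within `[0, +oo[, continuous (fun t => X t w)})
  (k_cov : forall t s, 0 <= t -> 0 <= s ->
     covariance P (X t) (X s) = (k t s)%:E)
  (k_cont : {within `[0, +oo[ `*` `[0, +oo[,
     continuous (fun p : R * R => k p.1 p.2)})
  (n : nat) (n_gt0 : (0 < n)%N) (T x : nat -> R) (y : R)
  (T1_gt0 : 0 < T 1%N)
  (T_incr : forall j, (1 <= j < n)%N -> T j < T j.+1)
  (k_pos : forall j, (1 <= j <= n)%N ->
     0 < conditional_covariance k T j.-1 (T j) (T j))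
  (kn_pos : \forall e \near 0^'+,
     0 < conditional_covariance k T n (T n + e) (T n + e))
  (gamma eta : R -> R) (kbar_n kbar_Y : R -> R -> R)
  (kbar_n_cov : covariance_function01 kbar_n) (kbar_n_pos : 0 < kbar_n 1 1)
  (kbar_Y_cov : covariance_function01 kbar_Y)
  (kbar_Y_0 : kbar_Y 0 0 = 0) (kbar_Y_1 : kbar_Y 1 1 = 0)
  (L U : R -> R)
  (L_cont : {within `[0, +oo[, continuous L})
  (U_cont : {within `[0, +oo[, continuous U})
  (LU : forall t, 0 <= t -> L t <= U t) :
  let Xn := conditional_process X k T x n in
  let kn := conditional_covariance k T n in
  let Y := fun e : R => bridge Xn kn (T n + e) y in
  let betabar := regression kbar_n 1 in
  let JY := rate_bridge kbar_Y (bridge_mean kbar_n (x n) y) (x n) y in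
  let tauU := fun e : R => hit_upper (Y e) U (T n) e in
  let tauL := fun e : R => hit_lower (Y e) L (T n) e in
  let logPU :=
    log_probability P eta (fun e => [set w | (tauU e w <= 1)%E]) in
  let logPL :=
    log_probability P eta (fun e => [set w | (tauL e w <= 1)%E]) in
  let logPLU :=
    log_probability P eta
      (fun e => [set w | (Order.min (tauL e w) (tauU e w) <= 1)%E]) in
  let IU := crossing_cost JY (@Gamma_upper R) (U (T n)) in
  let IL := crossing_cost JY (@Gamma_lower R) (L (T n)) in
  let ILU := (- lim (logPLU e @[e --> 0^'+]))%E in
  LDP P (rescaled_path Xn (T n)) gamma (rate_start kbar_n (x n)) ->
  LDP P (fun e => rescaled_path (Y e) (T n) e) eta JY ->
  [/\ x n < U (T n) -> y < U (T n) ->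
        IU = ereal_inf
          [set quotient0 (((U (T n) - x n) * (1 - betabar t)
                           + betabar t * (U (T n) - y)) ^+ 2)
                         (2 * kbar_Y t t) | t in `[0, 1]],
      x n > L (T n) -> y > L (T n) ->
        IL = ereal_inf
          [set quotient0 (((x n - L (T n)) * (1 - betabar t)
                           + betabar t * (y - L (T n))) ^+ 2)
                         (2 * kbar_Y t t) | t in `[0, 1]]
    & L (T n) < x n < U (T n) -> L (T n) < y < U (T n) ->
        logPU e @[e --> 0^'+] --> (- IU)%E ->
        logPL e @[e --> 0^'+] --> (- IL)%E ->
        cvg (logPLU e @[e --> 0^'+]) /\ ILU = Order.min IL IU].
Proof.
move=> Xn kn Y betabar JY tauU tauL logPU logPL logPLU IU IL ILU _ LDP_Y.
have T_ge0 i : (1 <= i <= n)%N -> 0 <= T i.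
  elim: i => [//|[|i] IH] /andP[_ i_n]; first exact: ltW.
  apply: ltW; apply: le_lt_trans (T_incr i.+1 _); last by rewrite i_n.
  by apply: IH; rewrite /= ltnW.
have Tn_ge0 : 0 <= T n by apply: T_ge0; rewrite n_gt0 leqnn.
have [h _ Jh] := LDP_finite_rate LDP_Y.
have m0 : bridge_mean kbar_n (x n) y 0 = x n.
  exact: rate_bridge_finite_start Jh.
have m1 : bridge_mean kbar_n (x n) y 1 = y.
  by apply: bridge_mean1; rewrite gt_eqF.
have m_cont := bridge_mean_continuous (x0 := x n) (y := y) kbar_n_cov.
split.
- move=> xU _; rewrite /IU /JY crossing_cost_upper//.
  congr ereal_inf; apply: eq_imagel => t _; congr quotient0; congr (_ ^+ 2).
  (* The numerator is the gap [U (T n) - m t], with [m] the mean of the limit bridge. *)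
  by rewrite /bridge_mean -/betabar; ring.
- move=> xL _; rewrite /IL /JY crossing_cost_lower//.
  congr ereal_inf; apply: eq_imagel => t _; congr quotient0.
  (* The stated numerator is [m t - L (T n)], opposite in sign to the one in
     [crossing_cost_lower]. *)
  rewrite -sqrrN; congr (_ ^+ 2).
  by rewrite /bridge_mean -/betabar; ring.
- move=> _ _ PU PL.
  (* Measurable values and continuous paths of [Y e] make the two crossing events measurable, as the
     estimate for their union requires. *)
  have mXn t : measurable_fun setT (Xn t).
    by apply: conditional_process_measurable => s; exact: measurable_funPT.
  have cXn w : {within `[0, +oo[, continuous (Xn ^~ w)}.
    by apply: conditional_process_continuous.
  have mY e t : measurable_fun setT (Y e t).
    apply: measurable_funB => //; apply: measurable_funM => //.
    exact: measurable_funB.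
  have cY e w : 0 < e -> {within `[0, +oo[, continuous (Y e ^~ w)}.
    move=> e0; apply: within_continuousBM; first exact: cXn.
    by apply: conditional_covariance_continuous => //; rewrite addr_ge0// ltW.
  have [[_ eta0] _ _ _] := LDP_Y.
  have logPLU_cvg : logPLU e @[e --> 0^'+] --> maxe (- IL)%E (- IU)%E.
    have -> : logPLU = log_probability P eta (fun e =>
        [set w | (tauL e w <= 1)%E] `|` [set w | (tauU e w <= 1)%E]).
      apply/funext => e; rewrite /logPLU /log_probability.
      do 3!congr (_ _); apply/seteqP; split=> w /=; rewrite ge_min => /orP//.
    apply: log_probabilityU_cvg => // e e0.
      by apply: measurable_hit_lower_le1 => // w; exact: cY.
    by apply: measurable_hit_upper_le1 => // w; exact: cY.
  split; first by apply/cvg_ex; exists (maxe (- IL)%E (- IU)%E).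
  (* Negation turns the maximum of the two logarithmic limits into the minimum of the costs. *)
  rewrite /ILU (cvg_lim _ logPLU_cvg)//.
  by rewrite -oppe_min oppeK.
Qed.
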